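(* Let $R$ be a left Noetherian ring, and let $\mathcal{AC}$ be the class of left $R$-modules satisfying the Auslander condition. Then the following are equivalent: (1) $\mathcal{AC}$ is a resolving subcategory of the category $R$-Mod of left $R$-modules. (2) ${}_RR$ (that is, $R$ regarded as a left $R$-module) satisfies the Auslander condition. (3) Each Gorenstein projective left $R$-module satisfies the Auslander condition. (4) Each Ding projective left $R$-module satisfies the Auslander condition. (5) Each Gorenstein flat left $R$-module satisfies the Auslander condition.
   Context: Rings are associative with identity; $R$-Mod is the category of all left $R$-modules. For a left $R$-module $M$, let $0\to M\to E^0(M)\to E^1(M)\to\cdots\to E^i(M)\to\cdots$ be a minimal injective coresolution of $M$. The module $M$ satisfies the Auslander condition if the flat dimension of the left $R$-module $E^i(M)$ is at most $i$ for every $i\geqslant 0$. A full subcategory $\mathcal{C}$ of $R$-Mod is resolving if it contains all projective modules and is closed under direct summands, extensions and kernels of surjective homomorphisms. A left $R$-module $G$ is Gorenstein projective if there is an exact sequence $\mathbf{P}:\cdots\to P_1\to P_0\to P^0\to P^1\to\cdots$ of projective left $R$-modules with $G\cong\ker(P^0\to P^1)$ such that $\mathrm{Hom}_R(\mathbf{P},Q)$ is exact for every projective left $R$-module $Q$. A left $R$-module $M$ is Ding projective if there is an exact sequence $\mathbf{P}:\cdots\to P_1\to P_0\to P^0\to P^1\to\cdots$ of projective left $R$-modules with $M\cong\ker(P^0\to P^1)$ such that $\mathrm{Hom}_R(\mathbf{P},F)$ is exact for every flat left $R$-module $F$. A left $R$-module $M$ is Gorenstein flat if there is an exact sequence $\mathbf{F}:\cdots\to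 F_1\to F_0\to F^0\to F^1\to\cdots$ of flat left $R$-modules with $M\cong\ker(F^0\to F^1)$ such that $E\otimes_R\mathbf{F}$ is exact for every injective right $R$-module $E$. *)

(* Defs.v *)
From HB Require Import structures.
From mathcomp Require Import all_boot all_algebra boolp freeg.

Set Implicit Arguments.
Unset Strict Implicit.
Unset Printing Implicit Defensive.

Import GRing.Theory.
Local Open Scope ring_scope.
Local Open Scope quotient_scope.

(* Right R-modules are [lmodType R^c]; the right action x r is                *)
(* [(r : R^c) *: x].                                                          *)

Section Tensor.
Variables (R : pzRingType) (X : lmodType R^c) (M : lmodType R).

Inductive tensor_rel : {freeg (X * M) / int} -> Prop :=
| tensor_rel0 : tensor_rel 0
| tensor_relB u v : tensor_rel u -> tensor_rel v -> tensor_rel (u - v)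
| tensor_relDl x x' m :
    tensor_rel (<< (x + x', m) >> - << (x, m) >> - << (x', m) >>)
| tensor_relDr x m m' :
    tensor_rel (<< (x, m + m') >> - << (x, m) >> - << (x, m') >>)
| tensor_relZ (r : R) x m :
    tensor_rel (<< ((r : R^c) *: x, m) >> - << (x, r *: m) >>).

Definition tensor_relb : {pred {freeg (X * M) / int}} :=
  [pred u | `[< tensor_rel u >]].

Fact tensor_relb_closed : zmod_closed tensor_relb.
Proof.
split=> [|u v]; first exact/asboolP/tensor_rel0.
by move=> /asboolP ru /asboolP rv; apply/asboolP/tensor_relB.
Qed.

HB.instance Definition _ := GRing.isZmodClosed.Build _ tensor_relb
  tensor_relb_closed.

Definition tensor : Type :=
  Quotient.quot (GRing.ZmodClosed.clone _ tensor_relb _).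

HB.instance Definition _ := GRing.Zmodule.on tensor.
HB.instance Definition _ := Quotient.on tensor.

Definition tens (x : X) (m : M) : tensor := \pi_tensor << (x, m) >>.

Lemma tensor_piB u v : \pi_tensor (u - v) = \pi_tensor u - \pi_tensor v.
Proof. exact: pi_is_zmod_morphism. Qed.

Lemma tensor_pi_eq u v : \pi_tensor u = \pi_tensor v <-> tensor_rel (u - v).
Proof.
split=> [/eqP|/asboolP H]; last apply/eqP.
  by rewrite -Quotient.idealrBE => /asboolP.
by rewrite -Quotient.idealrBE.
Qed.

Lemma tensor_pi0 : \pi_tensor 0 = 0.
Proof. by rewrite -(subrr 0) tensor_piB subrr. Qed.

Lemma tensor_piD u v : \pi_tensor (u + v) = \pi_tensor u + \pi_tensor v.
Proof. by rewrite -{1}[v]opprK -[- v]sub0r !tensor_piB tensor_pi0 sub0r opprK. Qed.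

Lemma tensDl x x' m : tens (x + x') m = tens x m + tens x' m.
Proof.
rewrite /tens -tensor_piD; apply/tensor_pi_eq; rewrite opprD addrA.
exact: tensor_relDl.
Qed.

Lemma tensDr x m m' : tens x (m + m') = tens x m + tens x m'.
Proof.
rewrite /tens -tensor_piD; apply/tensor_pi_eq; rewrite opprD addrA.
exact: tensor_relDr.
Qed.

Lemma tensZ (r : R) x m : tens ((r : R^c) *: x) m = tens x (r *: m).
Proof. exact/tensor_pi_eq/tensor_relZ. Qed.

Section Lift.
Variables (A : zmodType) (b : X -> M -> A).
Hypotheses (bDl : forall x x' m, b (x + x') m = b x m + b x' m).
Hypotheses (bDr : forall x m m', b x (m + m') = b x m + b x m').
Hypotheses (bZ : forall (r : R) x m, b ((r : R^c) *: x) m = b x (r *: m)).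

Let b' (p : X * M) : zmodule A := b p.1 p.2.

Let liftB u v : fglift b' (u - v) = fglift b' u - fglift b' v.
Proof. exact: lift_is_additive. Qed.

Let liftU p : fglift b' << p >> = b' p.
Proof. by rewrite liftU scale1r. Qed.

Lemma tensor_rel_lift u : tensor_rel u -> fglift b' u = 0.
Proof.
elim=> [|{}u v _ Hu _ Hv|x x' m|x m m'|r x m].
- by rewrite -(subrr 0) liftB subrr.
- by rewrite liftB Hu Hv subrr.
- by rewrite !liftB !liftU /b' /= bDl -addrA -opprD subrr.
- by rewrite !liftB !liftU /b' /= bDr -addrA -opprD subrr.
- by rewrite !liftB !liftU /b' /= bZ subrr.
Qed.

Definition tensor_lift (u : tensor) : A := fglift b' (repr u).

Lemma tensor_lift_pi u : tensor_lift (\pi_tensor u) = fglift b' u.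
Proof.
apply/eqP; rewrite -subr_eq0; apply/eqP; rewrite -[LHS]liftB.
by apply/tensor_rel_lift/tensor_pi_eq; rewrite reprK.
Qed.

Lemma tensor_liftB : zmod_morphism tensor_lift.
Proof.
by elim/quotW=> u; elim/quotW=> v; rewrite -tensor_piB !tensor_lift_pi liftB.
Qed.

Lemma tensor_liftE x m : tensor_lift (tens x m) = b x m.
Proof. by rewrite tensor_lift_pi liftU. Qed.

End Lift.

Lemma tensor_ext (A : zmodType) (h k : tensor -> A) :
    zmod_morphism h -> zmod_morphism k ->
  (forall x m, h (tens x m) = k (tens x m)) -> h =1 k.
Proof.
move=> hB kB hk.
pose S := [pred u | h u == k u].
have S_closed : zmod_closed S.
  split=> [|u v]; rewrite !inE; first by rewrite -(subrr 0) hB kB !subrr.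
  by move=> /eqP hu /eqP hv; rewrite hB kB hu hv.
have [S0 SD] := GRing.zmod_closedD S_closed.
have SN := GRing.zmod_closedN S_closed.
elim/quotW=> u; apply/eqP; rewrite -[u]freeg_sumE.
elim: (dom u) => [|p s IHs]; first by rewrite big_nil tensor_pi0.
rewrite big_cons tensor_piD; apply: (SD) => //.
have Sn n : \pi_tensor << n%:Z *g p >> \in S.
  elim: n => [|n IHn]; first by rewrite freegU0 tensor_pi0.
  rewrite -addn1 PoszD -freegUD tensor_piD; apply: (SD) => //.
  by rewrite inE; apply/eqP; case: p {IHs IHn} => x m; apply: hk.
case: (coeff p u) => n; first exact: Sn.
have -> : << Negz n *g p >> = 0 - << n.+1%:Z *g p >> :> {freeg _ / int}.
  by rewrite sub0r freegUN.
by rewrite tensor_piB tensor_pi0 sub0r; apply: (SN); apply: Sn.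
Qed.

End Tensor.

Section TensorMap.
Variables (R : pzRingType) (X X' : lmodType R^c) (M M' : lmodType R).
Variables (f : {linear X -> X'}) (g : {linear M -> M'}).

Definition tensor_map : tensor X M -> tensor X' M' :=
  tensor_lift (fun x m => tens (f x) (g m)).

Let bDl x x' m : tens (f (x + x')) (g m) = tens (f x) (g m) + tens (f x') (g m).
Proof. by rewrite linearD tensDl. Qed.

Let bDr x m m' : tens (f x) (g (m + m')) = tens (f x) (g m) + tens (f x) (g m').
Proof. by rewrite linearD tensDr. Qed.

Let bZ (r : R) x m : tens (f ((r : R^c) *: x)) (g m) = tens (f x) (g (r *: m)).
Proof. by rewrite !linearZ tensZ. Qed.

Lemma tensor_map_is_zmod_morphism : zmod_morphism tensor_map.
Proof. exact: tensor_liftB. Qed.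

HB.instance Definition _ := GRing.isZmodMorphism.Build _ _ tensor_map
  tensor_map_is_zmod_morphism.

Lemma tensor_mapE x m : tensor_map (tens x m) = tens (f x) (g m).
Proof. exact: tensor_liftE. Qed.

End TensorMap.

Definition surjective (A B : Type) (f : A -> B) : Prop :=
  forall y, exists x, f x = y.

Definition exact_at (A B C : zmodType) (f : A -> B) (g : B -> C) : Prop :=
  forall y, g y = 0 <-> exists x, f x = y.

Section Modules.
Variable R : pzRingType.
Implicit Types A B C D E F G M N P Q : lmodType R.

Definition short_exact A B C (f : {linear A -> B}) (g : {linear B -> C}) : Prop :=
  [/\ injective f, exact_at f g & surjective g].

Definition projective_module P : Prop :=
  forall M N (p : {linear M -> N}) (f : {linear P -> N}), surjective p ->
  exists h : {linear P -> M}, forall x, p (h x) = f x.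

Definition injective_module E : Prop :=
  forall M N (i : {linear M -> N}) (f : {linear M -> E}), injective i ->
  exists h : {linear N -> E}, forall x, h (i x) = f x.

Definition flat_module F : Prop :=
  forall (X Y Z : lmodType R^c) (f : {linear X -> Y}) (g : {linear Y -> Z}),
  exact_at f g -> exact_at (tensor_map f (@idfun F)) (tensor_map g (@idfun F)).

(* A flat resolution 0 -> F n -> ... -> F 0 -> M -> 0 is indexed by all of    *)
(* nat, with F i = 0 for i > n.                                               *)
Definition flat_dim_le M (n : nat) : Prop :=
  exists (F : nat -> lmodType R) (d : forall i, {linear F i.+1 -> F i})
         (e : {linear F 0%N -> M}),
  [/\ forall i, flat_module (F i),
      forall i, (n < i)%N -> forall x : F i, x = 0,
      surjective e,
      exact_at (d 0%N) e
    & forall i, exact_at (d i.+1) (d i)].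

(* The image of f is an essential submodule of B. *)
Definition essential_image A B (f : {linear A -> B}) : Prop :=
  forall S : {pred B}, submod_closed S ->
  (forall x, f x \in S -> f x = 0) -> forall y, y \in S -> y = 0.

(* 0 -> M -> E 0 -> E 1 -> ... ; minimality says that E 0 is an injective     *)
(* envelope of M and E i.+1 one of the image of d i, the cokernel of the map  *)
(* into E i.                                                                  *)
Definition minimal_injective_coresolution M (E : nat -> lmodType R)
    (e : {linear M -> E 0%N}) (d : forall i, {linear E i -> E i.+1}) : Prop :=
  [/\ forall i, injective_module (E i),
      [/\ injective e, exact_at e (d 0%N) & forall i, exact_at (d i) (d i.+1)],
      essential_image e
    & forall i, essential_image (d i)].

(* M has a minimal injective coresolution, unique up to isomorphism, so asking *)
(* for one below is the same as asking for all.                               *)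
Definition auslander_condition M : Prop :=
  exists (E : nat -> lmodType R) (e : {linear M -> E 0%N})
         (d : forall i, {linear E i -> E i.+1}),
  minimal_injective_coresolution e d /\ forall i, flat_dim_le (E i) i.

(* A full subcategory of R-Mod is given by its class of objects. *)
Definition resolving (C : lmodType R -> Prop) : Prop :=
  [/\ forall P, projective_module P -> C P,
      forall M N N' (f : {linear (N * N')%type -> M}), bijective f -> C M -> C N,
      forall A B D (f : {linear A -> B}) (g : {linear B -> D}),
        short_exact f g -> C A -> C D -> C B
    & forall A B D (f : {linear A -> B}) (g : {linear B -> D}),
        short_exact f g -> C B -> C D -> C A].

(* ... -> Pl 1 -> Pl 0 -> Pr 0 -> Pr 1 -> ... , where Pl n and Pr n stand for *)
(* P_n and P^n.                                                               *)
Record two_sided_seq := TwoSidedSeq {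
  Pl : nat -> lmodType R;
  Pr : nat -> lmodType R;
  dl : forall n, {linear Pl n.+1 -> Pl n};
  dm : {linear Pl 0%N -> Pr 0%N};
  dr : forall n, {linear Pr n -> Pr n.+1}
}.

Definition all_terms (T : lmodType R -> Prop) (P : two_sided_seq) : Prop :=
  (forall n, T (Pl P n)) /\ (forall n, T (Pr P n)).

Definition all_consecutive
    (K : forall A B C, {linear A -> B} -> {linear B -> C} -> Prop)
    (P : two_sided_seq) : Prop :=
  [/\ forall n, K _ _ _ (dl P n.+1) (dl P n),
      K _ _ _ (dl P 0%N) (dm P),
      K _ _ _ (dm P) (dr P 0%N)
    & forall n, K _ _ _ (dr P n) (dr P n.+1)].

Definition exact_seq : two_sided_seq -> Prop :=
  all_consecutive (fun A B C f g => exact_at f g).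

(* Exactness of Hom(C, Q) -> Hom(B, Q) -> Hom(A, Q) at Hom(B, Q). *)
Definition hom_exact_at Q A B C (f : {linear A -> B}) (g : {linear B -> C}) :
    Prop :=
  forall h : {linear B -> Q},
  (forall x, h (f x) = 0) <-> exists k : {linear C -> Q}, forall y, k (g y) = h y.

Definition hom_exact_seq Q : two_sided_seq -> Prop :=
  all_consecutive (@hom_exact_at Q).

Definition tensor_exact_seq (E : lmodType R^c) : two_sided_seq -> Prop :=
  all_consecutive (fun A B C f g =>
    exact_at (tensor_map (@idfun E) f) (tensor_map (@idfun E) g)).

(* G is isomorphic to the kernel of P^0 -> P^1. *)
Definition is_syzygy G (P : two_sided_seq) : Prop :=
  exists i : {linear G -> Pr P 0%N}, injective i /\ exact_at i (dr P 0%N).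

Definition gorenstein_projective G : Prop :=
  exists P : two_sided_seq, [/\ all_terms projective_module P, exact_seq P, is_syzygy G P
    & forall Q, projective_module Q -> hom_exact_seq Q P].

Definition ding_projective G : Prop :=
  exists P : two_sided_seq, [/\ all_terms projective_module P, exact_seq P, is_syzygy G P
    & forall F, flat_module F -> hom_exact_seq F P].

End Modules.

Definition gorenstein_flat (R : pzRingType) (G : lmodType R) : Prop :=
  exists F : two_sided_seq R, [/\ all_terms (@flat_module R) F, exact_seq F, is_syzygy G F
    & forall E : lmodType R^c, injective_module E -> tensor_exact_seq E F].

(* Ascending chain condition on left ideals, i.e. on submodules of R^o. *)
Definition left_noetherian (R : pzRingType) : Prop :=
  forall I : nat -> {pred R^o},
  (forall n, submod_closed (I n)) ->
  (forall n, {subset I n <= I n.+1}) ->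
  exists N, forall n, (N <= n)%N -> I n =i I N.

(* Main.v *)
From HB Require Import structures.
Require Import Defs.
From mathcomp Require Import all_boot all_algebra.
From mathcomp Require classical_sets functions.
From mathcomp Require Import boolp freeg.

(* Let R be left Noetherian. Having the first n terms of some injective       *)
(* coresolution of flat dimensions at most k, k + 1, ... passes to            *)
(* extensions (horseshoe), and from B (at level k) and C (at level k + 1) to  *)
(* the kernel of B -> C; by induction on n it therefore passes to every       *)
(* module with an infinite coresolution by modules satisfying the Auslander   *)
(* condition. As a minimal coresolution is a retract of any other, this       *)
(* reduces the theorem to: if R satisfies the condition, so do flat modules.  *)
(* If F is flat and N finitely generated, a syzygy of N maps to F through a   *)
(* finite free module, so classes in Ext^i (N, F) come from Ext^i (N, R^m).   *)
(* For N in the i-th cosyzygy of F, minimality makes the resulting map from N *)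
(* to the i-th cosyzygy of R^m injective. So finitely generated submodules of *)
(* E^i (F) embed in E^i (F) through a module of flat dimension at most i, and *)
(* Tor_(i+1) (-, E^i (F)) vanishes because it is detected on finitely many    *)
(* elements.                                                                  *)

Set Implicit Arguments.
Unset Strict Implicit.
Unset Printing Implicit Defensive.

Import GRing.Theory.
Local Open Scope ring_scope.

(** * Modules *)

(** The closure properties are proved for the flexible predicate [cores k n M] rather than for
    minimal coresolutions. A minimal coresolution is termwise a direct summand of any other
    injective one ([cores_minimal]) and flat dimension passes to direct summands, so the Auslander
    condition for [M] amounts to [cores 0 n M] for all [n] ([auslander_cores], [cores_auslander]).
    Extensions are then the horseshoe lemma. For the kernel [A] of a surjection [B -> C], embed [B]
    in its first injective [E]: then [E / A] is an extension of [E / B] by [C], and [A] gets one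
    more term than is known of [C] ([cores_kernel]). That gain drives an induction along infinite
    coresolutions ([cores_coresolution]).

    What remains is that flat modules inherit the condition from R ([flat_auslander]). Let F be
    flat, with cosyzygies Z^i inside E^i. A finitely generated N is finitely presented, so a map
    from N to F factors through some R^m ([flat_factor_row]). Dimension shifting
    ([ext_approx_shift]) turns this into: a map from N to Z^i is, up to a map through E^(i-1), a map
    through a module W with [cores i n W]. Minimality then makes finitely generated submodules of
    E^i factor through an injective of flat dimension at most i ([flat_dim_le_envelope]). This
    bounds the flat dimension of E^i, because flat dimension is read off from Tor, and Tor sees
    finitely many elements at a time ([flat_dim_tor], [flat_dim_le_local]).

    The complexes in (3), (4) and (5) all have flat terms, and their right halves coresolve the
    module in question, so (2) implies each of these statements. Conversely each of them applies to
    R, which is a syzygy of a contractible complex of projectives ([ex_contractible_seq]). *)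

Section Submodule.
Variables (R : pzRingType) (A : lmodType R) (S : {pred A}).
Hypothesis SP : submod_closed S.

(** The closure proof is an argument so that a structure instance can be attached to this head
    constant for an arbitrary [S]. *)
Definition subm_pred of submod_closed S : {pred A} := S.

HB.instance Definition _ :=
  GRing.isSubmodClosed.Build R A (subm_pred SP) SP.

Record subm := Subm { subm_val : A; _ : subm_val \in subm_pred SP }.

HB.instance Definition _ := [isSub for subm_val].
HB.instance Definition _ := [Choice of subm by <:].
HB.instance Definition _ := [SubChoice_isSubLmodule of subm by <:].

Lemma ex_submodule : exists (K : lmodType R) (i : {linear K -> A}),
  injective i /\ forall y, y \in S <-> exists x, i x = y.
Proof.
exists subm, (val : {linear subm -> A}); split; first exact: val_inj.
move=> y; split=> [Sy|[x <-]]; last by case: x.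
by exists (Subm (Sy : y \in subm_pred SP)).
Qed.

End Submodule.

Section QuotientModule.
Variables (R : pzRingType) (A : lmodType R) (S : {pred A}).
Hypothesis SP : submod_closed S.

Definition quom : Type := Quotient.quot (GRing.ZmodClosed.clone _ (subm_pred SP) _).

HB.instance Definition _ := GRing.Zmodule.on quom.
HB.instance Definition _ := Quotient.on quom.

Local Open Scope quotient_scope.

Lemma quom_pi_eq u v : \pi_quom u = \pi_quom v <-> u - v \in S.
Proof.
split=> [/eqP|H]; last apply/eqP.
  by rewrite -Quotient.idealrBE.
by rewrite -Quotient.idealrBE.
Qed.

Lemma quom_piB u v : \pi_quom (u - v) = \pi_quom u - \pi_quom v.
Proof. exact: pi_is_zmod_morphism. Qed.

Lemma quom_pi0 : \pi_quom 0 = 0.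
Proof. by rewrite -(subrr 0) quom_piB subrr. Qed.

Lemma quom_piD u v : \pi_quom (u + v) = \pi_quom u + \pi_quom v.
Proof.
by rewrite -{1}[v]opprK -[- v]sub0r !quom_piB quom_pi0 sub0r opprK.
Qed.

Definition quom_scale (r : R) (q : quom) : quom := \pi_quom (r *: repr q).

Lemma quom_scale_pi r u : quom_scale r (\pi_quom u) = \pi_quom (r *: u).
Proof.
apply/quom_pi_eq; rewrite -scalerBr.
apply: (@rpredZ _ _ (GRing.SubmodClosed.clone _ _ (subm_pred SP) _)).
by apply/quom_pi_eq; rewrite reprK.
Qed.

Lemma quom_scaleA a b v : quom_scale a (quom_scale b v) = quom_scale (a * b) v.
Proof. by elim/quotW: v => v; rewrite (quom_scale_pi b v) !quom_scale_pi scalerA. Qed.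
Lemma quom_scale1 : left_id 1 quom_scale.
Proof. by elim/quotW=> v; rewrite quom_scale_pi scale1r. Qed.
Lemma quom_scaleDr : right_distributive quom_scale +%R.
Proof.
move=> r; elim/quotW=> u; elim/quotW=> v.
by rewrite -quom_piD !quom_scale_pi scalerDr quom_piD.
Qed.
Lemma quom_scaleDl v : {morph quom_scale^~ v : a b / a + b}.
Proof.
by elim/quotW: v => v a b; rewrite !quom_scale_pi scalerDl quom_piD.
Qed.

HB.instance Definition _ := GRing.Zmodule_isLmodule.Build R quom
  quom_scaleA quom_scale1 quom_scaleDr quom_scaleDl.

Lemma quom_pi_is_linear : linear (\pi_quom : A -> quom).
Proof. by move=> r u v; rewrite quom_piD -quom_scale_pi. Qed.

HB.instance Definition _ := GRing.isLinear.Build R A quom *:%R \pi_quom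
  quom_pi_is_linear.

Lemma ex_quotient : exists (Q : lmodType R) (p : {linear A -> Q}),
  surjective p /\ forall y, p y = 0 <-> y \in S.
Proof.
exists quom, (\pi_quom : {linear A -> quom}); split.
  by move=> q; exists (repr q); rewrite /= reprK.
move=> y; have -> : (0 : quom) = \pi_quom (0 : A) by rewrite quom_pi0.
by rewrite quom_pi_eq subr0.
Qed.

End QuotientModule.

Lemma ex_linear (R : pzRingType) (A B : lmodType R) (f : A -> B) :
  linear f -> exists h : {linear A -> B}, forall x, h x = f x.
Proof.
move=> fl; pose F := GRing.isLinear.Build R A B *:%R f fl.
pose h : {linear A -> B} := HB.pack f F.
by exists h.
Qed.

(** * Kernels, cokernels, images and factorisations of linear maps *)

Section LinearTools.
Variable R : pzRingType.
Implicit Types A B C D E F G M N P Q : lmodType R.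

Lemma linear_injP A B (f : {linear A -> B}) :
  injective f <-> forall x, f x = 0 -> x = 0.
Proof.
split=> [fI x fx0|f0 x y fxy]; first by apply: fI; rewrite fx0 linear0.
by apply/eqP; rewrite -subr_eq0; apply/eqP/f0; rewrite linearB /= fxy subrr.
Qed.

Lemma kernel_submod A B (f : {linear A -> B}) :
  submod_closed [pred x | f x == 0].
Proof.
split=> [|a u v]; rewrite !inE ?linear0 // => /eqP fu /eqP fv.
by rewrite linearP /= fu fv scaler0 addr0.
Qed.

Lemma image_submod A B (f : {linear A -> B}) :
  submod_closed [pred y | `[< exists x, f x = y >]].
Proof.
split=> [|a u v]; rewrite !inE; first by apply/asboolP; exists 0; rewrite linear0.
move=> /asboolP[x <-] /asboolP[y <-].
by apply/asboolP; exists (a *: x + y); rewrite linearP.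
Qed.

Lemma ex_kernel A B (f : {linear A -> B}) :
  exists (K : lmodType R) (i : {linear K -> A}), injective i /\ exact_at i f.
Proof.
have [K [i [iI iE]]] := ex_submodule (kernel_submod f).
exists K, i; split=> // y; split=> [fy|].
  by apply/iE; rewrite inE fy.
by move=> /iE; rewrite inE => /eqP.
Qed.

Lemma ex_cokernel A B (f : {linear A -> B}) :
  exists (C : lmodType R) (p : {linear B -> C}), surjective p /\ exact_at f p.
Proof.
have [C [p [pS pE]]] := ex_quotient (image_submod f).
exists C, p; split=> // y; rewrite pE inE; split=> [/asboolP//|?].
exact/asboolP.
Qed.

Lemma ex_image A B (f : {linear A -> B}) :
  exists (C : lmodType R) (p : {linear A -> C}) (i : {linear C -> B}),
  [/\ surjective p, injective i & forall x, i (p x) = f x].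
Proof.
have [C [i [iI iE]]] := ex_submodule (image_submod f).
have iex x : exists y, i y = f x by apply/iE; rewrite inE; apply/asboolP; exists x.
have [p pE] := choice iex.
have pl : linear p by move=> a u v; apply: iI; rewrite linearP !pE linearP.
have [p' p'E] := ex_linear pl.
exists C, p', i; split=> // [y|x]; last by rewrite p'E pE.
have : i y \in [pred y | `[< exists x, f x = y >]] by apply/iE; exists y.
rewrite inE => /asboolP[x fx]; exists x; apply: iI.
by rewrite p'E pE.
Qed.

Lemma factor_surj A B C (p : {linear A -> B}) (f : {linear A -> C}) :
  surjective p -> (forall x, p x = 0 -> f x = 0) ->
  exists g : {linear B -> C}, forall x, g (p x) = f x.
Proof.
move=> pS pf; have [s sE] := choice pS.
have sf x : f (s (p x)) = f x.
  apply/eqP; rewrite -subr_eq0 -linearB; apply/eqP/pf.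
  by rewrite linearB /= sE subrr.
have gl : linear (f \o s).
  by move=> a u v /=; rewrite -{1}(sE u) -{1}(sE v) -linearP sf linearP.
have [g gE] := ex_linear gl.
by exists g => x; rewrite gE /= sf.
Qed.

Lemma factor_inj A B C (i : {linear A -> B}) (f : {linear C -> B}) :
  injective i -> (forall x, exists y, i y = f x) ->
  exists g : {linear C -> A}, forall x, i (g x) = f x.
Proof.
move=> iI /choice[g gE].
have gl : linear g by move=> a u v; apply: iI; rewrite linearP !gE linearP.
have [g' g'E] := ex_linear gl.
by exists g' => x; rewrite g'E gE.
Qed.

Lemma ex_pairing A B C (f : {linear A -> B}) (g : {linear A -> C}) :
  exists h : {linear A -> (B * C)%type}, forall x, h x = (f x, g x).
Proof. by apply: ex_linear => a u v; rewrite !linearP. Qed.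

Lemma ex_copairing A B C (f : {linear A -> C}) (g : {linear B -> C}) :
  exists h : {linear (A * B)%type -> C}, forall x, h x = f x.1 + g x.2.
Proof.
by apply: ex_linear => a u v /=; rewrite !linearP scalerDr addrACA.
Qed.

Lemma ex_inl A B : exists h : {linear A -> (A * B)%type}, forall x, h x = (x, 0).
Proof.
by apply: ex_linear => a u v; apply/eqP; rewrite xpair_eqE /= scaler0 addr0 !eqxx.
Qed.

Lemma ex_inr A B : exists h : {linear B -> (A * B)%type}, forall x, h x = (0, x).
Proof.
by apply: ex_linear => a u v; apply/eqP; rewrite xpair_eqE /= scaler0 addr0 !eqxx.
Qed.

Lemma short_exact_coker A B (i : {linear A -> B}) :
  injective i -> exists (C : lmodType R) (p : {linear B -> C}), short_exact i p.
Proof. by move=> iI; have [C [p [pS ip]]] := ex_cokernel i; exists C, p. Qed.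

Lemma short_exact_ker B C (p : {linear B -> C}) :
  surjective p -> exists (A : lmodType R) (i : {linear A -> B}), short_exact i p.
Proof. by move=> pS; have [A [i [iI ip]]] := ex_kernel p; exists A, i. Qed.

End LinearTools.

(** * Tensor products *)

Lemma zmod_morphismD (A B : zmodType) (h : A -> B) :
  zmod_morphism h -> h 0 = 0 /\ {morph h : u v / u + v}.
Proof.
move=> hB; have h0 : h 0 = 0 by rewrite -(subrr 0) hB subrr.
by split=> // u v; rewrite -{1}[v]opprK -[- v]sub0r !hB h0 sub0r opprK.
Qed.

Section ZmodQuotient.
Variables (A : zmodType) (S : {pred A}).
Hypothesis SP : zmod_closed S.

Definition zquo_pred of zmod_closed S : {pred A} := S.

HB.instance Definition _ := GRing.isZmodClosed.Build A (zquo_pred SP) SP.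

Lemma ex_zmod_quotient : exists (Q : zmodType) (p : A -> Q),
  [/\ zmod_morphism p, surjective p & forall y, p y = 0 <-> y \in S].
Proof.
pose Q := Quotient.quot (GRing.ZmodClosed.clone _ (zquo_pred SP) _).
exists Q, (\pi_Q)%qT; split; first exact: pi_is_zmod_morphism.
  by move=> q; exists (repr q); rewrite reprK.
move=> y; rewrite -[X in _ <-> X \in S]subr0.
have -> : (0 : Q) = (\pi_Q (0 : A))%qT.
  by rewrite -(subrr 0) pi_is_zmod_morphism subrr.
split=> [/eqP|H]; last apply/eqP.
  by rewrite -Quotient.idealrBE.
by rewrite -Quotient.idealrBE.
Qed.

End ZmodQuotient.

Section TensorTheory.
Variable R : pzRingType.
Implicit Types (X Y Z : lmodType R^c) (A B C M N : lmodType R).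

Lemma tens0l X M (m : M) : tens (0 : X) m = 0.
Proof. by apply: (addrI (tens 0 m)); rewrite -tensDl !addr0. Qed.

Lemma tens0r X M (x : X) : tens x (0 : M) = 0.
Proof. by apply: (addrI (tens x 0)); rewrite -tensDr !addr0. Qed.

Lemma tensNl X M (x : X) (m : M) : tens (- x) m = - tens x m.
Proof. by apply: (addrI (tens x m)); rewrite -tensDl !subrr tens0l. Qed.

Lemma tens_suml X M I (s : seq I) (F : I -> X) (m : M) :
  tens (\sum_(i <- s) F i) m = \sum_(i <- s) tens (F i) m.
Proof.
elim: s => [|i s IHs]; first by rewrite !big_nil tens0l.
by rewrite !big_cons tensDl IHs.
Qed.

Lemma tens_sumr X M I (s : seq I) (F : I -> M) (x : X) :
  tens x (\sum_(i <- s) F i) = \sum_(i <- s) tens x (F i).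
Proof.
elim: s => [|i s IHs]; first by rewrite !big_nil tens0r.
by rewrite !big_cons tensDr IHs.
Qed.

(** Closure under negation need not be asked: an integer multiple of a pure tensor is again pure,
    the integer being absorbed in the left factor. *)
Lemma tensor_ind X M (P : tensor X M -> Prop) :
    (forall x m, P (tens x m)) -> (forall u v, P u -> P v -> P (u + v)) ->
  forall t, P t.
Proof.
move=> Pt PD; elim/quotW=> u; rewrite -[u]freeg_sumE.
elim: (dom u) => [|[x m] s IHs].
  by rewrite big_nil tensor_pi0 -(tens0l X (0 : M)); apply: Pt.
rewrite big_cons tensor_piD; apply: (PD) => //.
suff [y ->] : exists y, (\pi_(tensor X M) << coeff (x, m) u *g (x, m) >>)%qT
                        = tens y m by apply: Pt.
have pos n : exists y, (\pi_(tensor X M) << n%:Z *g (x, m) >>)%qT = tens y m.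
  elim: n => [|n [y IHn]]; first by exists 0; rewrite freegU0 tensor_pi0 tens0l.
  by exists (y + x); rewrite -addn1 PoszD -freegUD tensor_piD IHn -tensDl.
case: (coeff (x, m) u) => n; first exact: pos.
have -> : << Negz n *g (x, m) >> = 0 - << n.+1%:Z *g (x, m) >> :> {freeg _ / int}.
  by rewrite sub0r freegUN.
have [y yE] := pos n.+1.
by exists (- y); rewrite tensor_piB tensor_pi0 sub0r yE tensNl.
Qed.

Lemma tensor_sum X M (t : tensor X M) :
  exists s : seq (X * M), t = \sum_(p <- s) tens p.1 p.2.
Proof.
elim/tensor_ind: t => [x m|u v [s ->] [s' ->]].
  by exists [:: (x, m)]; rewrite big_seq1.
by exists (s ++ s'); rewrite big_cat.
Qed.

Lemma tensor_map_comp X X' X'' M M' M'' (f : {linear X -> X'})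
    (f' : {linear X' -> X''}) (g : {linear M -> M'}) (g' : {linear M' -> M''})
    (f2 : {linear X -> X''}) (g2 : {linear M -> M''}) :
  (forall x, f' (f x) = f2 x) -> (forall m, g' (g m) = g2 m) ->
  forall t, tensor_map f' g' (tensor_map f g t) = tensor_map f2 g2 t.
Proof.
move=> ff gg; elim/tensor_ind=> [x m|u v IHu IHv].
  by rewrite !tensor_mapE ff gg.
by rewrite !raddfD /= IHu IHv.
Qed.

Lemma tensor_map_id X M (f : {linear X -> X}) (g : {linear M -> M}) :
  f =1 id -> g =1 id -> tensor_map f g =1 id.
Proof.
move=> ff gg; elim/tensor_ind=> [x m|u v IHu IHv].
  by rewrite !tensor_mapE ff gg.
by rewrite !raddfD /= IHu IHv.
Qed.

Lemma tensor_map_0l X X' M M' (f : {linear X -> X'}) (g : {linear M -> M'}) t :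
  (forall x, f x = 0) -> tensor_map f g t = 0.
Proof.
move=> f0; elim/tensor_ind: t => [x m|u v IHu IHv].
  by rewrite tensor_mapE f0 tens0l.
by rewrite raddfD /= IHu IHv addr0.
Qed.

Lemma tensor_map_0r X X' M M' (f : {linear X -> X'}) (g : {linear M -> M'}) t :
  (forall x, g x = 0) -> tensor_map f g t = 0.
Proof.
move=> g0; elim/tensor_ind: t => [x m|u v IHu IHv].
  by rewrite tensor_mapE g0 tens0r.
by rewrite raddfD /= IHu IHv addr0.
Qed.

Lemma tensor_map_Dr X X' M M' (f : {linear X -> X'}) (g g1 g2 : {linear M -> M'}) t :
  (forall x, g x = g1 x + g2 x) ->
  tensor_map f g t = tensor_map f g1 t + tensor_map f g2 t.
Proof.
move=> gE; elim/tensor_ind: t => [x m|u v IHu IHv].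
  by rewrite !tensor_mapE gE tensDr.
by rewrite !raddfD /= IHu IHv addrACA.
Qed.

Lemma tensor_map_inj X X' M M' (f : {linear X -> X'}) (g : {linear M -> M'}) :
  injective (tensor_map f g) <-> forall t, tensor_map f g t = 0 -> t = 0.
Proof.
split=> [fI x fx0|f0 x y fxy]; first by apply: fI; rewrite fx0 raddf0.
by apply/eqP; rewrite -subr_eq0; apply/eqP/f0; rewrite raddfB /= fxy subrr.
Qed.

Lemma tensor_map_surj X X' M M' (f : {linear X -> X'}) (g : {linear M -> M'}) :
  surjective f -> surjective g -> surjective (tensor_map f g).
Proof.
move=> fS gS; elim/tensor_ind=> [x m|u v [u' <-] [v' <-]].
  by have [[x' <-] [m' <-]] := (fS x, gS m); exists (tens x' m'); rewrite tensor_mapE.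
by exists (u' + v'); rewrite raddfD.
Qed.

Lemma tensor_image_closed X X' M M' (f : {linear X -> X'}) (g : {linear M -> M'}) :
  zmod_closed [pred y | `[< exists x, tensor_map f g x = y >]].
Proof.
split=> [|u v]; rewrite !inE; first by apply/asboolP; exists 0; rewrite raddf0.
move=> /asboolP[x <-] /asboolP[y <-].
by apply/asboolP; exists (x - y); rewrite raddfB.
Qed.

(** Right exactness. Let [p] be the projection of X ⊗ B onto the cokernel of X ⊗ A. Sending (x, c)
    to the class of x ⊗ b, for any b over c, is well defined and balanced, so [p] factors through X
    ⊗ C and the kernel of X ⊗ g lies in that of [p]. *)
Lemma tensor_exactr X A B C (f : {linear A -> B}) (g : {linear B -> C}) :
    exact_at f g -> surjective g ->
  exact_at (tensor_map (@idfun X) f) (tensor_map (@idfun X) g).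
Proof.
move=> fg gS t; split=> [gt0|[u <-]]; last first.
  rewrite (tensor_map_comp (f2 := idfun) (g2 := \0)) ?tensor_map_0r //.
  by move=> m; apply/fg; exists m.
have [Q [p [pB _ pE]]] := ex_zmod_quotient (tensor_image_closed (@idfun X) f).
have [p0 pD] := zmod_morphismD pB.
have [s sE] := choice gS.
pose b (x : X) (c : C) := p (tens x (s c)).
have bg x m : b x (g m) = p (tens x m).
  apply/eqP; rewrite -subr_eq0 -pB -tensNl addrC; apply/eqP/pE.
  rewrite inE; apply/asboolP.
  have [a aE] : exists a, f a = s (g m) - m by apply/fg; rewrite linearB /= sE subrr.
  by exists (tens x a); rewrite tensor_mapE aE tensDr addrC tensNl /= -[- m]scaleN1r
    -tensZ scaleN1r tensNl.
have bDl x x' m : b (x + x') m = b x m + b x' m by rewrite /b tensDl pD.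
have bDr x m m' : b x (m + m') = b x m + b x m'.
  by rewrite -{1}(sE m) -{1}(sE m') -linearD bg tensDr pD.
have bZ (r : R) x m : b ((r : R^c) *: x) m = b x (r *: m).
  by rewrite -{2}(sE m) -linearZ bg /b tensZ.
have lB := tensor_liftB bDl bDr bZ; have [l0 lD] := zmod_morphismD lB.
have lE u : tensor_lift b (tensor_map idfun g u) = p u.
  elim/tensor_ind: u => [x m|u v IHu IHv].
    by rewrite tensor_mapE tensor_liftE.
  by rewrite pD -IHu -IHv raddfD /= lD.
have /pE : p t = 0.
  by rewrite -lE gt0 l0.
by rewrite inE => /asboolP.
Qed.

Lemma tensor_exactl M X Y Z (f : {linear X -> Y}) (g : {linear Y -> Z}) :
    exact_at f g -> surjective g ->
  exact_at (tensor_map f (@idfun M)) (tensor_map g (@idfun M)).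
Proof.
move=> fg gS t; split=> [gt0|[u <-]]; last first.
  rewrite (tensor_map_comp (f2 := \0) (g2 := idfun)) ?tensor_map_0l //.
  by move=> m; apply/fg; exists m.
have [Q [p [pB _ pE]]] := ex_zmod_quotient (tensor_image_closed f (@idfun M)).
have [p0 pD] := zmod_morphismD pB.
have [s sE] := choice gS.
pose b (z : Z) (m : M) := p (tens (s z) m).
have bg x m : b (g x) m = p (tens x m).
  apply/eqP; rewrite -subr_eq0 -pB -tensNl -tensDl; apply/eqP/pE.
  rewrite inE; apply/asboolP.
  have [a aE] : exists a, f a = s (g x) - x by apply/fg; rewrite linearB /= sE subrr.
  by exists (tens a m); rewrite tensor_mapE aE.
have bDl x x' m : b (x + x') m = b x m + b x' m.
  by rewrite -{1}(sE x) -{1}(sE x') -linearD bg tensDl pD.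
have bDr x m m' : b x (m + m') = b x m + b x m' by rewrite /b tensDr pD.
have bZ (r : R) x m : b ((r : R^c) *: x) m = b x (r *: m).
  by rewrite -{1}(sE x) -linearZ bg tensZ.
have lB := tensor_liftB bDl bDr bZ; have [l0 lD] := zmod_morphismD lB.
have lE u : tensor_lift b (tensor_map g idfun u) = p u.
  elim/tensor_ind: u => [x m|u v IHu IHv].
    by rewrite tensor_mapE tensor_liftE.
  by rewrite pD -IHu -IHv raddfD /= lD.
have /pE : p t = 0.
  by rewrite -lE gt0 l0.
by rewrite inE => /asboolP.
Qed.

Lemma tensor_map_swap X X' M M' (f : {linear X -> X'}) (g : {linear M -> M'}) t :
  tensor_map f idfun (tensor_map idfun g t) =
  tensor_map idfun g (tensor_map f idfun t).
Proof. by rewrite !(tensor_map_comp (f2 := f) (g2 := g)). Qed.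

End TensorTheory.

Arguments tensor_exactl {R} M {X Y Z f g}.
Arguments tensor_exactr {R} X {A B C f g}.

(** * Free modules with coordinates *)

Section FreeModule.
Import classical_sets functions.
Variable S : pzRingType.

(** Freeness as data, through dual coordinate forms. The ring is arbitrary, so that the same record
    serves left modules over [R] and right modules, seen over [R^c]. *)
Record basis (P : lmodType S) := Basis {
  basis_idx : eqType;
  basis_vec : basis_idx -> P;
  basis_coord : basis_idx -> {linear P -> S^o};
  basis_dual : forall i j, basis_coord i (basis_vec j) = (i == j)%:R;
  basis_span : forall p, exists s : seq basis_idx,
    [/\ uniq s, forall i, i \notin s -> basis_coord i p = 0
      & p = \sum_(i <- s) (basis_coord i p : S) *: basis_vec i] }.

Lemma big_uniq_sub (V : zmodType) (I : eqType) (s s' : seq I) (F : I -> V) :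
    uniq s -> uniq s' -> {subset s <= s'} -> (forall i, i \notin s -> F i = 0) ->
  \sum_(i <- s') F i = \sum_(i <- s) F i.
Proof.
move=> Us Us' ss F0; rewrite (bigID (mem s)) /= addrC big1 ?add0r => [|i /F0 //].
rewrite -big_filter; apply: perm_big; apply: uniq_perm; rewrite ?filter_uniq //.
by move=> i; rewrite mem_filter andb_idr // => /ss.
Qed.

Definition finsupp (X : choiceType) : {pred (X -> S^o)} :=
  fun f => `[< exists s : seq X, forall x, x \notin s -> f x = 0 >].

Lemma finsupp_submod (X : choiceType) : submod_closed (@finsupp X).
Proof.
split=> [|a u v]; first by apply/asboolP; exists [::].
move=> /asboolP[s su] /asboolP[s' sv]; apply/asboolP; exists (s ++ s') => x.
rewrite mem_cat negb_or => /andP[xs xs'].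
change (a *: u x + v x = 0).
by rewrite su // sv // scaler0 addr0.
Qed.

Lemma ex_free_cover (X : lmodType S) :
  exists (P : lmodType S) (b : basis P) (p : {linear P -> X}), surjective p.
Proof.
have [P [i [iI iE]]] := ex_submodule (@finsupp_submod X).
pose d (x : X) : X -> S^o := fun y => (y == x)%:R.
have dP x : exists p, i p = d x.
  by apply/iE/asboolP; exists [:: x] => y; rewrite inE /d => /negPf->.
have [e eE] := choice dP.
have cl x : linear (fun p => i p x : S^o) by move=> a u v; rewrite linearP.
have [c cE] := choice (fun x => ex_linear (cl x)).
have dual x y : c x (e y) = (x == y)%:R by rewrite cE eE.
have span p : exists s : seq X,
    [/\ uniq s, forall x, x \notin s -> c x p = 0 & p = \sum_(x <- s) (c x p : S) *: e x].
  have /asboolP[s0 s0E] : i p \in @finsupp X by apply/iE; exists p.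
  pose s := undup s0; have us : uniq s by apply: undup_uniq.
  have sE x : x \notin s -> c x p = 0 by rewrite mem_undup cE => /s0E.
  exists s; split=> //; apply: iI; apply: funext => y.
  rewrite linear_sum fct_sumE -cE.
  rewrite (eq_bigr (fun x => (c x p : S) *: ((y == x)%:R : S^o))); last first.
    by move=> x _; rewrite linearZ eE.
  have [ys|yns] := boolP (y \in s).
    rewrite (bigD1_seq y) //= eqxx big1 ?addr0 => [|x /negPf yx].
      by rewrite -[RHS]/(c y p * 1) mulr1.
    by rewrite eq_sym yx scaler0.
  rewrite sE // big_seq big1 // => x xs; have [yx|] := eqVneq y x.
    by rewrite yx xs in yns.
  by rewrite scaler0.
pose b := Basis dual span; exists P, b.
have supp p : {s : seq X | [/\ uniq s, forall x, x \notin s -> c x p = 0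
                             & p = \sum_(x <- s) (c x p : S) *: e x]}.
  exact/cid/span.
(* The sum runs over a chosen support; [vE] shows that any larger duplicate-free list gives the same
   value, so that linearity can be checked on a common list. *)
pose v p := \sum_(x <- sval (supp p)) (c x p : S) *: x.
have vE p s : uniq s -> {subset sval (supp p) <= s} -> v p = \sum_(x <- s) (c x p : S) *: x.
  move=> us ss; rewrite (big_uniq_sub _ us ss) //; case: (supp p) => //= t [] //.
  by move=> _ + _ x => h /h ->; rewrite scale0r.
have vl : linear v.
  move=> a p q.
  pose s := undup (sval (supp p) ++ sval (supp q) ++ sval (supp (a *: p + q))).
  have us : uniq s by apply: undup_uniq.
  rewrite !(vE _ s) //; try by move=> x; rewrite mem_undup !mem_cat => ->; rewrite ?orbT.
  rewrite scaler_sumr -big_split; apply: eq_bigr => x _ /=.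
  by rewrite linearP scalerDl -[a *: c x p]/(a * c x p) scalerA.
have [h hE] := ex_linear vl.
exists h => x; exists (e x); rewrite hE.
rewrite (vE _ (undup (x :: sval (supp (e x))))) ?undup_uniq //; last first.
  by move=> y; rewrite mem_undup inE => ->; rewrite orbT.
rewrite (bigD1_seq x) ?undup_uniq ?mem_undup ?inE ?eqxx //=.
rewrite dual eqxx scale1r big1 ?addr0 // => y /negPf yx.
by rewrite dual yx scale0r.
Qed.

End FreeModule.

(** * Flat modules and flat dimension *)

Section Flatness.
Variable R : pzRingType.
Implicit Types (L Q X Y Z : lmodType R^c) (A B C K M N P : lmodType R).

Definition lflat M := forall X Y (f : {linear X -> Y}),
  injective f -> injective (tensor_map f (@idfun M)).

Definition rflat X := forall A B (g : {linear A -> B}),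
  injective g -> injective (tensor_map (@idfun X) g).

Lemma flat_lflat M : flat_module M -> lflat M.
Proof.
move=> Mf X Y f fI; apply/tensor_map_inj => t ft0.
have [K [i [iI iE]]] := ex_kernel f.
have /(Mf _ _ _ _ _ iE)[s <-] := ft0.
rewrite tensor_map_0l // => x; apply: fI; rewrite linear0.
by apply/iE; exists x.
Qed.

Lemma lflat_flat M : lflat M -> flat_module M.
Proof.
move=> Mf X Y Z f g fg.
have [C [p [i [pS iI ip]]]] := ex_image g.
have fp : exact_at f p.
  move=> y; rewrite -fg; split=> [py|gy]; first by rewrite -ip py linear0.
  by apply: iI; rewrite ip gy linear0.
have fpM := tensor_exactl M fp pS.
move=> t; rewrite -fpM.
rewrite -(tensor_map_comp (f := p) (f' := i) (g := idfun) (g' := idfun)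
   (f2 := g) (g2 := idfun)) //.
split=> [|->]; last by rewrite raddf0.
exact: (proj1 (tensor_map_inj _ _) (Mf _ _ _ iI)).
Qed.

Lemma lflat_retract M N (s : {linear N -> M}) (r : {linear M -> N}) :
  (forall x, r (s x) = x) -> lflat M -> lflat N.
Proof.
move=> rs Mf X Y f fI; apply/tensor_map_inj => t ft0.
have st0 : tensor_map idfun s t = 0.
  by apply: (Mf _ _ _ fI); rewrite tensor_map_swap ft0 !raddf0.
rewrite -[t](tensor_map_id (f := idfun) (g := r \o s)) //.
by rewrite -(tensor_map_comp (f := idfun) (f' := idfun) (g := s) (g' := r)) // st0 raddf0.
Qed.

(** X ⊗ P is a direct sum of copies of X: the coordinate maps to X are natural in X, and an element
    is recovered from its coordinates. Injectivity is therefore checked coordinate by coordinate. *)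
Lemma lflat_basis P (b : basis P) : lflat P.
Proof.
have coordP X (i : basis_idx b) : exists c : tensor X P -> X,
    [/\ c 0 = 0, {morph c : u v / u + v}
      & forall x p, c (tens x p) = ((basis_coord i p : R) : R^c) *: x].
  pose c x p := ((basis_coord i p : R) : R^c) *: (x : X).
  have cDl x x' p : c (x + x') p = c x p + c x' p by rewrite /c scalerDr.
  have cDr x p p' : c x (p + p') = c x p + c x p'.
    by rewrite /c linearD -scalerDl.
  have cZ (r : R) x p : c ((r : R^c) *: x) p = c x (r *: p).
    by rewrite /c linearZ scalerA.
  have [c0 cD] := zmod_morphismD (tensor_liftB cDl cDr cZ).
  by exists (tensor_lift c); split=> // x p; rewrite tensor_liftE.
have {}coordP X := choice (coordP X).
have span X c (cP : forall i : basis_idx b, [/\ c i 0 = 0, {morph c i : u v / u + v}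
      & forall x p, c i (tens x p) = ((basis_coord i p : R) : R^c) *: (x : X)]) t :
    exists s : seq (basis_idx b), forall s', uniq s' -> {subset s <= s'} ->
      t = \sum_(i <- s') tens (c i t) (basis_vec i).
  elim/tensor_ind: t => [x p|u v [s su] [s' sv]].
    have [s [us s0 sp]] := basis_span b p; exists s => s' us' ss.
    have E : p = \sum_(i <- s') (basis_coord i p : R) *: basis_vec i.
      rewrite (@big_uniq_sub _ _ s s' _ us us' ss) // => i /s0 ->; exact: scale0r.
    rewrite {1}E tens_sumr; apply: eq_bigr => i _.
    by case: (cP i) => _ _ ->; rewrite tensZ.
  exists (s ++ s') => s2 us2 ss.
  have h i (si : i \in s) : i \in s2 by apply: ss; rewrite mem_cat si.
  have h' i (si : i \in s') : i \in s2 by apply: ss; rewrite mem_cat si orbT.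
  rewrite {1}(su s2 us2 h) {1}(sv s2 us2 h').
  rewrite -big_split; apply: eq_bigr => i _ /=.
  by case: (cP i) => _ -> _; rewrite tensDl.
move=> X Y f fI; apply/tensor_map_inj => t ft0.
have [cX cXP] := coordP X; have [cY cYP] := coordP Y.
have nat i u : cY i (tensor_map f idfun u) = f (cX i u).
  elim/tensor_ind: u => [x p|u v IHu IHv].
    by rewrite tensor_mapE; case: (cXP i) (cYP i) => _ _ -> [_ _ ->]; rewrite linearZ.
  by case: (cXP i) (cYP i) => _ -> _ [_ cD _]; rewrite raddfD cD IHu IHv linearD.
have [s sE] := span _ _ cXP t.
rewrite (sE (undup s)) ?undup_uniq => [|//|i]; last by rewrite mem_undup.
rewrite big1 // => i _; suff -> : cX i t = 0 by rewrite tens0l.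
by apply: fI; rewrite linear0 -nat ft0; case: (cYP i).
Qed.

Lemma rflat_basis (X : lmodType R^c) (b : basis X) : rflat X.
Proof.
have coordP M (i : basis_idx b) : exists c : tensor X M -> M,
    [/\ c 0 = 0, {morph c : u v / u + v}
      & forall x m, c (tens x m) = (basis_coord i x : R) *: m].
  pose c x m := (basis_coord i x : R) *: (m : M).
  have cDl x x' m : c (x + x') m = c x m + c x' m by rewrite /c linearD -scalerDl.
  have cDr x m m' : c x (m + m') = c x m + c x m' by rewrite /c scalerDr.
  have cZ (r : R) x m : c ((r : R^c) *: x) m = c x (r *: m).
    by rewrite /c linearZ scalerA.
  have [c0 cD] := zmod_morphismD (tensor_liftB cDl cDr cZ).
  by exists (tensor_lift c); split=> // x p; rewrite tensor_liftE.
have {}coordP M := choice (coordP M).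
have span M c (cP : forall i : basis_idx b, [/\ c i 0 = 0, {morph c i : u v / u + v}
      & forall x m, c i (tens x m) = (basis_coord i x : R) *: (m : M)]) t :
    exists s : seq (basis_idx b), forall s', uniq s' -> {subset s <= s'} ->
      t = \sum_(i <- s') tens (basis_vec i) (c i t).
  elim/tensor_ind: t => [x m|u v [s su] [s' sv]].
    have [s [us s0 sp]] := basis_span b x; exists s => s' us' ss.
    have E : x = \sum_(i <- s') (basis_coord i x : R^c) *: basis_vec i.
      rewrite (@big_uniq_sub _ _ s s' _ us us' ss) // => i /s0 ->; exact: scale0r.
    rewrite {1}E tens_suml; apply: eq_bigr => i _.
    by case: (cP i) => _ _ ->; rewrite tensZ.
  exists (s ++ s') => s2 us2 ss.
  have h i (si : i \in s) : i \in s2 by apply: ss; rewrite mem_cat si.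
  have h' i (si : i \in s') : i \in s2 by apply: ss; rewrite mem_cat si orbT.
  rewrite {1}(su s2 us2 h) {1}(sv s2 us2 h').
  rewrite -big_split; apply: eq_bigr => i _ /=.
  by case: (cP i) => _ -> _; rewrite tensDr.
move=> A B g gI; apply/tensor_map_inj => t gt0.
have [cA cAP] := coordP A; have [cB cBP] := coordP B.
have nat i u : cB i (tensor_map idfun g u) = g (cA i u).
  elim/tensor_ind: u => [x p|u v IHu IHv].
    by rewrite tensor_mapE; case: (cAP i) (cBP i) => _ _ -> [_ _ ->]; rewrite linearZ.
  by case: (cAP i) (cBP i) => _ -> _ [_ cD _]; rewrite raddfD cD IHu IHv linearD.
have [s sE] := span _ _ cAP t.
rewrite (sE (undup s)) ?undup_uniq => [|//|i]; last by rewrite mem_undup.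
rewrite big1 // => i _; suff -> : cA i t = 0 by rewrite tens0r.
by apply: gI; rewrite linear0 -nat gt0; case: (cBP i).
Qed.

Lemma ex_lflat_cover M :
  exists (P : lmodType R) (p : {linear P -> M}), lflat P /\ surjective p.
Proof.
have [P [b [p pS]]] := ex_free_cover M.
by exists P, p; split=> //; apply: lflat_basis b.
Qed.

Lemma ex_rflat_cover X :
  exists (Q : lmodType R^c) (p : {linear Q -> X}), rflat Q /\ surjective p.
Proof.
have [P [b [p pS]]] := ex_free_cover X.
by exists P, p; split=> //; apply: rflat_basis b.
Qed.

Lemma projective_flat P : projective_module P -> flat_module P.
Proof.
move=> Pp; have [F [p [Ff pS]]] := ex_lflat_cover P.
have [s sE] := Pp _ _ p (@idfun P) pS.
exact/lflat_flat/(lflat_retract sE).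
Qed.

(* [tor_vanishes n X M] states that Tor_(n+1) (X, M) = 0, by shifting along   *)
(* right flat presentations of X.                                             *)
Fixpoint tor_vanishes n X M : Prop :=
  forall L Q (i : {linear L -> Q}) (p : {linear Q -> X}), rflat Q ->
  short_exact i p ->
  if n is n'.+1 then tor_vanishes n' L M else injective (tensor_map i (@idfun M)).

(** For the direct implication, cover Y by a flat Q and let A be the preimage of X in Q, the kernel
    of Q -> Y / X. A lift to A ⊗ M of an element killed in Y ⊗ M comes, inside Q ⊗ M, from the
    kernel K of Q -> Y. As A ⊗ M -> Q ⊗ M is injective, the lift already comes from K ⊗ M, which
    dies in X ⊗ M. *)
Lemma tor_vanishes_lflat M : (forall X, tor_vanishes 0 X M) <-> lflat M.
Proof.
split=> [Mt X Y f fI|Mf X L Q i p _ [iI _ _]]; last exact: Mf.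
have [C [p [pS fp]]] := ex_cokernel f.
have [Q [q [Qf qS]]] := ex_rflat_cover Y.
have pqS : surjective (p \o q).
  by move=> c; have [y <-] := pS c; have [x <-] := qS y; exists x.
have [A [j [jI jE]]] := ex_kernel (p \o q).
have jinj := Mt C A Q j (p \o q) Qf (And3 jI jE pqS).
have [|h hE] := factor_inj (f := q \o j) fI.
  by move=> a; apply/fp; apply/jE; exists a.
have hS : surjective h.
  move=> x; have [y yE] := qS (f x).
  have /jE[a aE] : p (q y) = 0 by rewrite yE; apply/fp; exists x.
  by exists a; apply: fI; rewrite hE /= aE.
have [K [k [kI kE]]] := ex_kernel q.
have [|l lE] := factor_inj (f := k) jI.
  by move=> z; apply/jE; rewrite /= (_ : q (k z) = 0) ?linear0 //; apply/kE; exists z.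
have idS : surjective (@idfun M) by move=> m; exists m.
apply/tensor_map_inj => t ft0.
have [t' t'E] := tensor_map_surj hS idS t.
have : tensor_map q (@idfun M) (tensor_map j idfun t') = 0.
  rewrite (tensor_map_comp (f2 := q \o j) (g2 := idfun)) //.
  by rewrite -(tensor_map_comp (g := idfun) (g' := idfun) hE (fun=> erefl)) t'E.
move=> /(iffLR (tensor_exactl M kE qS _))[w wE].
have t'w : t' = tensor_map l idfun w.
  by apply: jinj; rewrite (tensor_map_comp (f2 := k) (g2 := idfun)).
rewrite -t'E t'w (tensor_map_comp (f2 := h \o l) (g2 := idfun)) //.
rewrite tensor_map_0l // => z; apply: fI; rewrite hE linear0 /= lE.
by apply/kE; exists z.
Qed.

(** Tor_2 (X, M) = Tor_1 (X, K). Both L ⊗ P -> Q ⊗ P and Q ⊗ K -> Q ⊗ P are injective, so L ⊗ K -> Q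
    ⊗ K and L ⊗ K -> L ⊗ P have the same kernel. The latter kernel is Tor_1 (L, M), compared by a
    snake chase with the kernel of L' ⊗ M -> Q' ⊗ M. *)
Lemma tor_vanishes_shift0 K P M (a : {linear K -> P}) (b : {linear P -> M}) X :
  short_exact a b -> lflat P -> tor_vanishes 1 X M <-> tor_vanishes 0 X K.
Proof.
move=> [aI ab bS] Pf; split=> [Mt L Q i p Qf ip|Kt L Q i p Qf ip L' Q' j q Q'f jq].
  have [iI _ _] := ip.
  have [Q' [q [Q'f qS]]] := ex_rflat_cover L.
  have [L' [j jq]] := short_exact_ker qS; have [jI jqE _] := jq.
  have jM := Mt _ _ _ _ Qf ip _ _ _ _ Q'f jq.
  have idS (N : lmodType R) : surjective (@idfun N) by move=> m; exists m.
  have idX (N : lmodType R^c) : surjective (@idfun N) by move=> m; exists m.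
  apply/tensor_map_inj => t it0.
  have [t' t'E] := tensor_map_surj qS (@idS K) t.
  have : tensor_map q (@idfun P) (tensor_map idfun a t') = 0.
    rewrite tensor_map_swap t'E; apply: (Pf _ _ _ iI).
    by rewrite tensor_map_swap it0 !raddf0.
  move=> /(iffLR (tensor_exactl P jqE qS _))[v vE].
  have : tensor_map (@idfun L') b v = 0.
    apply: jM; rewrite tensor_map_swap vE raddf0.
    rewrite (tensor_map_comp (f2 := idfun) (g2 := b \o a)) //.
    by rewrite tensor_map_0r // => x; apply/ab; exists x.
  move=> /(iffLR (tensor_exactr L' ab bS _))[w wE].
  have -> : t = tensor_map q idfun (tensor_map j idfun w).
    rewrite -t'E; congr (tensor_map _ _ _); apply: (Q'f _ _ _ aI).
    by rewrite -tensor_map_swap wE vE.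
  rewrite (tensor_map_comp (f2 := q \o j) (g2 := idfun)) // tensor_map_0l // => x.
  by apply/jqE; exists x.
have [iI _ _] := ip; have [jI jqE qS] := jq.
have iK := Kt _ _ _ _ Qf ip.
have idX (N : lmodType R^c) : surjective (@idfun N) by move=> m; exists m.
apply/tensor_map_inj => t jt0.
have [t0 t0E] := tensor_map_surj (idX L') bS t.
have : tensor_map (@idfun Q') b (tensor_map j idfun t0) = 0.
  by rewrite -tensor_map_swap t0E.
move=> /(iffLR (tensor_exactr Q' ab bS _))[s sE].
have : tensor_map q (@idfun K) s = 0.
  apply: iK; rewrite raddf0; apply: (Qf _ _ _ aI); rewrite raddf0.
  rewrite -!tensor_map_swap sE (tensor_map_comp (f2 := q \o j) (g2 := idfun)) //.
  rewrite [X in tensor_map _ _ X]tensor_map_0l ?raddf0 // => x.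
  by apply/jqE; exists x.
move=> /(iffLR (tensor_exactl K jqE qS _))[s' s'E].
have E : t0 = tensor_map idfun a s'.
  by apply: (Pf _ _ _ jI); rewrite tensor_map_swap s'E sE.
rewrite -t0E E (tensor_map_comp (f2 := idfun) (g2 := b \o a)) // tensor_map_0r //.
by move=> x; apply/ab; exists x.
Qed.

Lemma tor_vanishes_shift n K P M (a : {linear K -> P}) (b : {linear P -> M}) X :
  short_exact a b -> lflat P -> tor_vanishes n.+1 X M <-> tor_vanishes n X K.
Proof.
move=> ab Pf; elim: n X => [|n IHn] X; first exact: (tor_vanishes_shift0 X ab Pf).
by split=> Xt L Q i p Qf ip; apply/IHn/(Xt _ _ _ _ Qf ip).
Qed.

Lemma flat_dim_le_lflat M : flat_dim_le M 0 -> lflat M.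
Proof.
move=> [F [d [e [Ff F0 eS d0e _]]]].
have eI : injective e.
  apply/linear_injP => x /d0e[y <-]; by rewrite (F0 1%N isT y) linear0.
have [s sE] := factor_inj (f := @idfun M) eI eS.
exact: lflat_retract sE (flat_lflat (Ff _)).
Qed.

Lemma flat_dim_le_split M n : flat_dim_le M n.+1 ->
  exists (K P : lmodType R) (a : {linear K -> P}) (b : {linear P -> M}),
  [/\ short_exact a b, lflat P & flat_dim_le K n].
Proof.
move=> [F [d [e [Ff F0 eS d0e dd]]]].
have [K [a ae]] := short_exact_ker eS; have [aI aeE _] := ae.
exists K, (F 0), a, e; split=> //; first exact: flat_lflat.
have [|e' e'E] := factor_inj (f := d 0) aI.
  by move=> x; apply/aeE/d0e; exists x.
exists (fun i => F i.+1), (fun i => d i.+1), e'; split=> //.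
- by move=> i ni; apply: F0.
- move=> k; have /d0e[x xE] : e (a k) = 0 by apply/aeE; exists k.
  by exists x; apply: aI; rewrite e'E.
- move=> x; rewrite -(dd 0 x) -e'E; split=> [->|]; first by rewrite linear0.
  by rewrite -{1}(linear0 a) => /aI.
Qed.

Lemma flat_dim_le_cons K P M (a : {linear K -> P}) (b : {linear P -> M}) n :
  short_exact a b -> flat_module P -> flat_dim_le K n -> flat_dim_le M n.+1.
Proof.
move=> [aI ab bS] Pf [F [d [e [Ff F0 eS d0e dd]]]].
pose F' i := if i is j.+1 then F j else P.
pose d' i : {linear F' i.+1 -> F' i} :=
  match i with 0 => a \o e | j.+1 => d j end.
exists F', d', b; split=> //.
- by case.
- by case=> // i ni; apply: F0.
- move=> y; rewrite ab; split=> [[x <-]|[x <-]]; last by exists (e x).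
  by have [z <-] := eS x; exists z.
- case=> [|i] x; last exact: dd.
  rewrite -(d0e x) /=; split=> [|->]; last by rewrite linear0.
  by rewrite -{1}(linear0 a) => /aI.
Qed.

Lemma flat_dim_le0 M : flat_module M -> flat_dim_le M 0.
Proof.
move=> Mf; pose F i : lmodType R := if i is 0 then M else 'rV[R]_0.
pose d i : {linear F i.+1 -> F i} := \0.
have F0 i (x : F i.+1) : x = 0 by apply/matrixP => ? [].
exists F, d, (@idfun M); split=> //.
(* The zero module is flat, being a retract of [M]. *)
- case=> // i; apply/lflat_flat/(lflat_retract (M := M) (s := \0) (r := \0)).
    by move=> x; apply/esym/(F0 i).
  exact: flat_lflat.
- by case.
- by move=> x; exists x.
- by move=> x; split=> [x0|[? <-//]]; exists 0; apply: esym x0.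
- by move=> i x; split=> [_|//]; exists 0; apply/esym/(F0 i).
Qed.

(** This frees flat dimension from the choice of a resolution: the syzygy of any flat cover can be
    used, by dimension shifting. *)
Lemma flat_dim_tor n M : flat_dim_le M n <-> forall X, tor_vanishes n X M.
Proof.
split; elim: n M => [|n IHn] M.
- by move=> /flat_dim_le_lflat; rewrite -tor_vanishes_lflat.
- move=> /flat_dim_le_split[K [P [a [b [ab Pf Kn]]]]] X.
  by apply/(tor_vanishes_shift _ _ ab) => //; apply: IHn.
- by rewrite tor_vanishes_lflat => /lflat_flat/flat_dim_le0.
- move=> Mt; have [P [b [Pf bS]]] := ex_lflat_cover M.
  have [K [a ab]] := short_exact_ker bS.
  apply: (flat_dim_le_cons ab (lflat_flat Pf)); apply: IHn => X.
  exact/(tor_vanishes_shift _ _ ab).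
Qed.

End Flatness.

(** * Flat dimension of products, and its detection on finite sets of elements *)

Section FlatDimension.
Variable R : pzRingType.
Implicit Types (L Q X Y Z : lmodType R^c) (A B C K M N P : lmodType R).

Lemma flat_dim_le_mono M m n : (m <= n)%N -> flat_dim_le M m -> flat_dim_le M n.
Proof.
move=> mn [F [d [e [Ff F0 eS d0e dd]]]]; exists F, d, e; split=> // i ni.
exact/F0/(leq_ltn_trans mn).
Qed.

Lemma tor_vanishes_prod n X A B :
  tor_vanishes n X A -> tor_vanishes n X B -> tor_vanishes n X (A * B)%type.
Proof.
elim: n X => [|n IHn] X At Bt L Q i p Qf ip; last first.
  by apply: IHn; [apply: At Qf ip|apply: Bt Qf ip].
have iA := At _ _ _ _ Qf ip; have iB := Bt _ _ _ _ Qf ip.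
have [inl inlE] := ex_inl A B; have [inr inrE] := ex_inr A B.
apply/tensor_map_inj => t it0.
have t1 : tensor_map (@idfun L) (fst : {linear (A * B)%type -> A}) t = 0.
  by apply: iA; rewrite tensor_map_swap it0 !raddf0.
have t2 : tensor_map (@idfun L) (snd : {linear (A * B)%type -> B}) t = 0.
  by apply: iB; rewrite tensor_map_swap it0 !raddf0.
rewrite -[t](tensor_map_id (f := idfun) (g := idfun)) //.
rewrite (tensor_map_Dr _ (g1 := inl \o fst) (g2 := inr \o snd)); last first.
  by case=> a b; rewrite /= inlE inrE /= -[RHS]/(a + 0, 0 + b) addr0 add0r.
rewrite -(tensor_map_comp (f := idfun) (f' := idfun) (g := fst) (g' := inl)) //.
rewrite -(tensor_map_comp (f := idfun) (f' := idfun) (g := snd) (g' := inr)) //.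
by rewrite t1 t2 !raddf0 addr0.
Qed.

Lemma flat_dim_le_prod A B n :
  flat_dim_le A n -> flat_dim_le B n -> flat_dim_le (A * B)%type n.
Proof.
move=> /flat_dim_tor At /flat_dim_tor Bt; apply/flat_dim_tor => X.
exact: tor_vanishes_prod.
Qed.

(* [j] transports the relations witnessing the vanishing, provided that their *)
(* finitely many elements of M lie in the image of [i].                       *)
Lemma tensor_eq0_finite X M (s0 : seq (X * M)) :
    \sum_(p <- s0) tens p.1 p.2 = 0 ->
  exists s : seq M, forall N (i : {linear N -> M}) (j : M -> N),
    cancel i j -> (forall x, x \in s -> exists y, i y = x) ->
    \sum_(p <- s0) tens p.1 (j p.2) = 0.
Proof.
pose U : {freeg (X * M) / int} := \sum_(p <- s0) << p >>.
have piU : (\pi_(tensor X M) U)%qT = \sum_(p <- s0) tens p.1 p.2.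
  rewrite /U; elim: (s0) => [|[x m] s IHs]; first by rewrite !big_nil tensor_pi0.
  by rewrite !big_cons tensor_piD IHs.
move=> s00; have {s00 piU} : tensor_rel U.
  by rewrite -[U]subr0; apply/tensor_pi_eq; rewrite piU s00 tensor_pi0.
pose b N (j : M -> N) (p : X * M) : zmodule (tensor X N) := tens p.1 (j p.2).
have bB N (j : M -> N) u v : fglift (b N j) (u - v) = fglift (b N j) u - fglift (b N j) v.
  exact: lift_is_additive.
have bU N (j : M -> N) p : fglift (b N j) << p >> = b N j p by rewrite liftU scale1r.
suff claim u : tensor_rel u -> exists s : seq M,
    forall N (i : {linear N -> M}) (j : M -> N),
    cancel i j -> (forall x, x \in s -> exists y, i y = x) -> fglift (b N j) u = 0.
  move=> /claim[s sE]; exists s => N i j ij sij; rewrite -[RHS](sE N i j ij sij).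
  have [b0 bD] := zmod_morphismD (bB N j).
  by rewrite /U (big_morph _ bD b0); apply: eq_bigr => p _; rewrite bU.
elim=> [|{}u v _ [s sE] _ [s' sE']|x x' m|x m m'|r x m].
- by exists [::] => N i j _ _; rewrite -(subrr 0) bB subrr.
- exists (s ++ s') => N i j ij ss; rewrite bB.
  rewrite (sE N i j) ?(sE' N i j) ?subrr // => y ys; apply: ss;
  by rewrite mem_cat ys ?orbT.
- exists [::] => N i j _ _; rewrite !bB !bU /b /= tensDl.
  by rewrite -addrA -opprD subrr.
- exists [:: m; m'] => N i j ij ss; rewrite !bB !bU /b /=.
  have [[y yE] [y' yE']] : (exists y, i y = m) /\ (exists y, i y = m').
    by split; apply: ss; rewrite !inE eqxx ?orbT.
  by rewrite -yE -yE' -linearD !ij tensDr -addrA -opprD subrr.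
- exists [:: m] => N i j ij ss; rewrite !bB !bU /b /=.
  have [y yE] : exists y, i y = m by apply: ss; rewrite inE.
  by rewrite -yE -linearZ !ij tensZ subrr.
Qed.

Lemma ex_left_inverse M N (i : {linear N -> M}) :
  injective i -> exists j : M -> N, cancel i j.
Proof.
move=> iI; have H (m : M) : exists n, (exists y, i y = m) -> i n = m.
  by have [[y yE]|nex] := pselect (exists y, i y = m); [exists y|exists 0].
have [j jE] := choice H; exists j => n; apply: iI.
by apply: jE; exists n.
Qed.

(** An element of the kernel of L ⊗ M -> Q ⊗ M involves finitely many elements of M, and so do the
    relations that kill its image. With N containing all of them, it lifts to L ⊗ N and already dies
    in Q ⊗ N; its image in L ⊗ Z is then zero, and so is its image in L ⊗ M. *)
Lemma flat_dim_le_local M n :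
    (forall s : seq M, exists (N Z : lmodType R) (i : {linear N -> M})
       (a : {linear N -> Z}) (b : {linear Z -> M}),
     [/\ injective i, forall x, x \in s -> exists y, i y = x,
         forall x, b (a x) = i x & flat_dim_le Z n]) ->
  flat_dim_le M n.
Proof.
move=> Mloc; apply/flat_dim_tor => X.
have {Mloc} : forall s : seq M, exists (N Z : lmodType R) (i : {linear N -> M})
       (a : {linear N -> Z}) (b : {linear Z -> M}),
     [/\ injective i, forall x, x \in s -> exists y, i y = x,
         forall x, b (a x) = i x & tor_vanishes n X Z].
  move=> s; have [N [Z [i [a [b [iI si ba /flat_dim_tor Zn]]]]]] := Mloc s.
  by exists N, Z, i, a, b.
elim: n X => [|n IHn] X Mloc L Q f p Qf fp; last first.
  apply: IHn => s; have [N [Z [i [a [b [iI si ba Zn]]]]]] := Mloc s.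
  by exists N, Z, i, a, b; split=> //; apply: Zn Qf fp.
apply/tensor_map_inj => t; have [s0 ->] := tensor_sum t.
rewrite raddf_sum /=; under eq_bigr do rewrite tensor_mapE.
rewrite -(big_map (fun p => (f p.1, p.2)) predT (fun p => tens p.1 p.2)).
move=> /tensor_eq0_finite[s sE].
have [N [Z [i [a [b [iI si ba Zn]]]]]] := Mloc (s ++ [seq p.2 | p <- s0]).
have [j ij] := ex_left_inverse iI.
pose t' := \sum_(p <- s0) tens p.1 (j p.2).
have -> : \sum_(p <- s0) tens p.1 p.2 = tensor_map idfun i t'.
  rewrite raddf_sum /= big_seq [RHS]big_seq; apply: eq_bigr => q qs.
  rewrite tensor_mapE; have [|y yE] := si q.2.
    by rewrite mem_cat map_f ?orbT.
  by rewrite -yE ij.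
have ft' : tensor_map f idfun t' = 0.
  rewrite raddf_sum -[RHS](sE N i j ij); last first.
    by move=> x xs; apply: si; rewrite mem_cat xs.
  by rewrite big_map; apply: eq_bigr => q _; rewrite /= tensor_mapE.
have at' : tensor_map (@idfun L) a t' = 0.
  by apply: (Zn _ _ _ _ Qf fp); rewrite tensor_map_swap ft' !raddf0.
rewrite -(tensor_map_comp (f := idfun) (f' := idfun) (g := a) (g' := b)) //.
by rewrite at' raddf0.
Qed.

End FlatDimension.

(** * Injective envelopes *)

Section DivisibleExtension.
Import classical_sets functions.
Local Open Scope classical_set_scope.

Lemma Zorn_above (T : Type) (P : set (set T)) (G0 : set T) :
    P G0 ->
    (forall F : set (set T), F !=set0 -> F `<=` P -> total_on F subset ->
      P (\bigcup_(X in F) X)) ->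
  exists A, [/\ G0 `<=` A, P A & forall B, A `<=` B -> P B -> B `<=` A].
Proof.
(* Adjoining [G0] to every set makes the empty chain harmless: its bound is [G0] itself. *)
move=> PG0 PF; have [F FP Ftot|A [PA Amax]] := @Zorn_bigcup _ [set G | P (G `|` G0)].
  rewrite /=; have [[X FX]|F0] := pselect (F !=set0); last first.
    suff -> : \bigcup_(X in F) X `|` G0 = G0 by [].
    by apply/seteqP; split=> [x [[X FX]|//]|x]; [case: F0; exists X|right].
  have -> : \bigcup_(X in F) X `|` G0 = \bigcup_(X in [set Y `|` G0 | Y in F]) X.
    apply/seteqP; split=> [x [[Y FY Yx]|G0x]|x [_ [Y FY <-] [Yx|G0x]]].
    - by exists (Y `|` G0); [exists Y|left].
    - by exists (X `|` G0); [exists X|right].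
    - by left; exists Y.
    - by right.
  apply: PF => [|_ [Y FY <-]|_ _ [Y FY <-] [Z FZ <-]].
  - by exists (X `|` G0), X.
  - exact: FP.
  - by have [YZ|ZY] := Ftot _ _ FY FZ; [left|right]; apply: setUSS.
exists (A `|` G0); split=> // B AB PB.
have BE : B `|` G0 = B.
  by apply/seteqP; split=> [x [//|G0x]|x]; [apply: AB; right|left].
move=> x Bx; left; apply: contrapT => nAx; apply: (Amax B); last by rewrite /= BE.
by split=> [y Ay|BA]; [apply: AB; left|apply: nAx; apply: BA].
Qed.

Section Divisible.
Variables (D : zmodType).
Hypothesis D_div : forall (d : D) n, (0 < n)%N -> exists e, e *+ n = d.

(** A partial homomorphism from B to D as its graph, so that the bound of a chain is a plain
    union. *)
Definition additive_graph (B : zmodType) (G : set (B * D)) :=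
  [/\ G (0, 0), forall x y d e, G (x, d) -> G (y, e) -> G (x - y, d - e)
    & forall d, G (0, d) -> d = 0].

Lemma additive_graph_mulrz (B : zmodType) (G : set (B * D)) x d (k : int) :
  additive_graph G -> G (x, d) -> G (x *~ k, d *~ k).
Proof.
move=> [G0 GB _] Gx.
have GN y e : G (y, e) -> G (- y, - e) by move=> /(GB _ _ _ _ G0); rewrite !sub0r.
have Gn n : G (x *+ n, d *+ n).
  elim: n => [//|n IHn]; rewrite !mulrSr -[X in _ + X]opprK -[X in (_, _ + X)]opprK.
  exact/GB/GN.
by case: k => n; [apply: Gn|rewrite NegzE !mulrNz; apply/GN/Gn].
Qed.

(** A value at [b] compatible with [G]. The k for which k b lies in the domain form an ideal of the
    integers. If no positive k does, 0 works; otherwise divide the value at m b by the least such m,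
    which divides every other k by Euclidean division. *)
Lemma additive_graph_slope (B : zmodType) (G : set (B * D)) b :
  additive_graph G -> exists e, forall (k : int) d, G (b *~ k, d) -> d = e *~ k.
Proof.
move=> Gadd; have [G0 GB Gf] := Gadd.
have [[n [n0 [d0 Gn]]]|nex] :=
    pselect (exists n, (0 < n)%N /\ exists d, G (b *+ n, d)); last first.
  exists 0 => k d Gk; rewrite mul0rz.
  case: k Gk => [[|n]|n] Gk; first exact: Gf.
    by case: nex; exists n.+1; split=> //; exists d.
  case: nex; exists n.+1; split=> //; exists (- d).
  have := GB _ _ _ _ G0 Gk; rewrite !sub0r NegzE mulrNz opprK.
  by [].
pose Q n := (0 < n)%N && `[< exists d, G (b *+ n, d) >].
have exQ : exists n, Q n by exists n; rewrite /Q n0; apply/asboolP; exists d0.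
case: (ex_minnP exQ) => m /andP[m0 /asboolP[d1 Gm]] mmin {n n0 d0 Gn exQ}.
have [e eE] := D_div d1 m0; exists e => k d Gk.
have Gr : G (b *~ (k %% m)%Z, d - d1 *~ (k %/ m)%Z).
  have -> : b *~ (k %% m)%Z = b *~ k - (b *+ m) *~ (k %/ m)%Z.
      by rewrite -[b *+ m]/(b *~ m) -mulrzA [(m%:Z * _)%R]mulrC /modz mulrzDr mulrNz.
  apply: (GB _ _ _ _ Gk); exact: additive_graph_mulrz Gm.
have rm : (k %% m)%Z = 0.
  have m0' : (0 < m%:Z)%R by rewrite ltz_nat.
  have r0 : (0 <= (k %% m)%Z)%R by apply: modz_ge0; case: (m) m0.
  have := ltz_pmod k m0'; move: Gr r0.
  case: (k %% m)%Z => // -[//|r] Gr _; rewrite ltz_nat => rm.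
  suff /mmin : Q r.+1 by rewrite leqNgt rm.
  by apply/andP; split=> //; apply/asboolP; exists (d - d1 *~ (k %/ m)%Z).
move: Gr; rewrite rm mulr0z => /Gf/eqP; rewrite subr_eq0 => /eqP ->.
rewrite -eE -[e *+ m]/(e *~ m) -mulrzA [X in _ = e *~ X](divz_eq k m) rm addr0.
by rewrite [(m%:Z * _)%R]mulrC.
Qed.

Lemma divisible_extend (A B : zmodType) (i : A -> B) (f : A -> D) :
    zmod_morphism i -> injective i -> zmod_morphism f ->
  exists g : B -> D, zmod_morphism g /\ forall a, g (i a) = f a.
Proof.
move=> iB iI fB; pose G0 : set (B * D) := [set (i a, f a) | a in setT].
have i0 : i 0 = 0 by rewrite -(subrr 0) iB subrr.
have f0 : f 0 = 0 by rewrite -(subrr 0) fB subrr.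
have G0add : additive_graph G0.
  split=> [|x y d e [a _ [<- <-]] [a' _ [<- <-]]|d [a _ [ia0 <-]]].
  - by exists 0 => //; rewrite i0 f0.
  - by exists (a - a') => //; rewrite iB fB.
  - by rewrite -f0; congr f; apply: iI; rewrite ia0.
have [F [X FX] FP Ftot|G [G0G Gadd Gmax]] := Zorn_above G0add.
  split=> [|x y d e [Y FY Yx] [Z FZ Zy]|d [Y FY Yd]].
  - by exists X => //; case: (FP _ FX).
  - have [YZ|ZY] := Ftot _ _ FY FZ.
      by exists Z => //; case: (FP _ FZ) => _ + _; apply; [apply: YZ|].
    by exists Y => //; case: (FP _ FY) => _ + _; apply; [|apply: ZY].
  - by case: (FP _ FY) => _ _; apply.
have [G00 GB Gf] := Gadd.
have Gtot b : exists d, G (b, d).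
  have [e eE] := additive_graph_slope b Gadd.
  pose G1 : set (B * D) :=
    [set p | exists x d (k : int), G (x, d) /\ p = (x + b *~ k, d + e *~ k)].
  exists e; suff G1add : additive_graph G1.
    apply: (Gmax G1) => // [[x d] Gx|]; first by exists x, d, 0; rewrite !mulr0z !addr0.
    by exists 0, 0, 1; rewrite !mulr1z !add0r.
  split=> [|x y d d' [x1 [d1 [k [Gx [-> ->]]]]] [x2 [d2 [l [Gy [-> ->]]]]]|d].
  - by exists 0, 0, 0; rewrite !mulr0z !addr0.
  - exists (x1 - x2), (d1 - d2), (k - l); split; first exact: GB.
    by congr (_, _); rewrite mulrzBr opprD addrACA.
  - move=> [x [d' [k [Gx [/esym/eqP + ->]]]]]; rewrite addr_eq0 => /eqP xE.
    move: Gx; rewrite xE -mulrNz => /eE ->; by rewrite mulrNz addNr.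
have [g gE] := choice Gtot; exists g; split.
  move=> x y; apply/eqP; rewrite -subr_eq0; apply/eqP/Gf.
  have -> : (0, g (x - y) - (g x - g y)) = (x - y - (x - y), g (x - y) - (g x - g y)) :> B * D.
    by rewrite subrr.
  by apply: (GB) => //; apply: (GB).
move=> a; apply/eqP; rewrite -subr_eq0; apply/eqP/Gf; rewrite -(subrr (i a)).
by apply: (GB) => //; apply: G0G; exists a.
Qed.

End Divisible.

End DivisibleExtension.

(** * Coinduced modules Hom_Z (R, D) *)

Module CoinducedModule.
Section Coinduced.
Import functions.
Variables (R : pzRingType) (D : zmodType).

Definition coind_pred : {pred (R -> D)} := fun g => `[< zmod_morphism g >].

Lemma coind_pred_closed : zmod_closed coind_pred.
Proof.
split=> [|u v]; first by apply/asboolP => x y; rewrite subrr.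
move=> /asboolP uB /asboolP vB; apply/asboolP => x y.
change (u (x - y) - v (x - y) = u x - v x - (u y - v y)).
by rewrite uB vB !opprD opprK addrACA.
Qed.

HB.instance Definition _ := GRing.isZmodClosed.Build (R -> D) coind_pred
  coind_pred_closed.

Record coind := Coind { coind_val : R -> D; _ : coind_val \in coind_pred }.

HB.instance Definition _ := [isSub for coind_val].
HB.instance Definition _ := [Choice of coind by <:].
HB.instance Definition _ := [SubChoice_isSubZmodule of coind by <:].

Lemma coind_valB (g : coind) : zmod_morphism (val g).
Proof. by case: g => g gP; apply/asboolP. Qed.

Lemma coind_addE (g h : coind) s : val (g + h) s = val g s + val h s.
Proof. by []. Qed.

Lemma coind_eq (g h : coind) : (forall s, val g s = val h s) -> g = h.
Proof. by move=> gh; apply: val_inj; apply: funext. Qed.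

Lemma coind_scale_subproof (r : R) (g : coind) :
  (fun s => val g (s * r)) \in coind_pred.
Proof. by apply/asboolP => x y; rewrite mulrBl coind_valB. Qed.

Definition coind_scale r g := Coind (coind_scale_subproof r g).

Lemma coind_scaleA a b g : coind_scale a (coind_scale b g) = coind_scale (a * b) g.
Proof. by apply: coind_eq => s /=; rewrite mulrA. Qed.
Lemma coind_scale1 : left_id 1 coind_scale.
Proof. by move=> g; apply: coind_eq => s /=; rewrite mulr1. Qed.
Lemma coind_scaleDr : right_distributive coind_scale +%R.
Proof. by move=> r g h; apply: coind_eq. Qed.
Lemma coind_scaleDl g : {morph coind_scale^~ g : a b / a + b}.
Proof.
move=> a b; apply: coind_eq => s; rewrite coind_addE /= mulrDr.
by have [_ ->] := zmod_morphismD (@coind_valB g).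
Qed.

HB.instance Definition _ := GRing.Zmodule_isLmodule.Build R coind
  coind_scaleA coind_scale1 coind_scaleDr coind_scaleDl.

(* Hom_R (N, Hom_Z (R, D)) = Hom_Z (N, D). *)
Lemma coind_injective :
    (forall (d : D) n, (0 < n)%N -> exists e, e *+ n = d) ->
  injective_module coind.
Proof.
move=> D_div M N i f iI.
have fB : zmod_morphism (fun m => val (f m) 1) by move=> x y; rewrite linearB.
have iB : zmod_morphism i by move=> x y; rewrite linearB.
have [g [gB gE]] := divisible_extend D_div iB iI fB.
have hP n : (fun s : R => g (s *: n)) \in coind_pred.
  by apply/asboolP => x y; rewrite scalerBl gB.
have hl : linear (fun n => Coind (hP n)).
  move=> a u v; apply: coind_eq => s; rewrite coind_addE /=.
  have [_ gD] := zmod_morphismD gB.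
  by rewrite scalerDr gD !scalerA.
have [h hE] := ex_linear hl; exists h => x; rewrite hE.
apply: coind_eq => s /=; rewrite -linearZ gE linearZ.
by change (val (f x) (1 * s) = val (f x) s); rewrite mul1r.
Qed.

Lemma ex_coind_map (M : lmodType R) (j : M -> D) : zmod_morphism j ->
  exists h : {linear M -> coind}, forall m s, val (h m) s = j (s *: m).
Proof.
move=> jB; have hP m : (fun s : R => j (s *: m)) \in coind_pred.
  by apply/asboolP => x y; rewrite scalerBl jB.
have hl : linear (fun n => Coind (hP n)).
  move=> a u v; apply: coind_eq => s; rewrite coind_addE /=.
  have [_ jD] := zmod_morphismD jB.
  by rewrite scalerDr jD !scalerA.
by have [h hE] := ex_linear hl; exists h => m s; rewrite hE.
Qed.

End Coinduced.
End CoinducedModule.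
Import CoinducedModule.

(** Write M as the quotient of the free abelian group on M by the kernel K of evaluation. Then D is
    the rational vector space on M modulo K: it is divisible, and M embeds in it because integral
    combinations embed in rational ones. *)
Lemma ex_divisible_embedding (M : zmodType) : exists (D : zmodType) (j : M -> D),
  [/\ forall (d : D) n, (0 < n)%N -> exists e, e *+ n = d,
      zmod_morphism j & injective j].
Proof.
pose V : zmodType := {freeg M / rat}.
pose phi : {freeg M / int} -> zmodule V := fglift (fun m => << m >> : zmodule V).
have phiB u v : phi (u - v) = phi u - phi v by apply: lift_is_additive.
pose ev : {freeg M / int} -> zmodule M := fglift (fun m => m : zmodule M).
have evB u v : ev (u - v) = ev u - ev v by apply: lift_is_additive.
have [phi0 phiD] := zmod_morphismD phiB.
have [ev0 evD] := zmod_morphismD evB.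
have phiU m : phi << m >> = << m >> by rewrite /phi liftU scale1r.
have evU m : ev << m >> = m by rewrite /ev liftU scale1r.
pose S : {pred V} := fun v => `[< exists u, phi u = v /\ ev u = 0 >].
have SP : zmod_closed S.
  split=> [|u v]; first by apply/asboolP; exists 0; rewrite phi0 ev0.
  move=> /asboolP[u' [<- eu]] /asboolP[v' [<- ev']]; apply/asboolP.
  by exists (u' - v'); rewrite phiB evB eu ev' subrr.
have [D [p [pB pS pE]]] := ex_zmod_quotient SP.
have [p0 pD] := zmod_morphismD pB.
have coeff_phi x u : coeff x (phi u : {freeg M / rat}) = (coeff x u)%:~R.
  pose c v := coeff x (phi v : {freeg M / rat}).
  pose c' (v : {freeg M / int}) : rat := (coeff x v)%:~R.
  have [|c0 cD] := @zmod_morphismD _ _ c.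
    by move=> v w; rewrite /c phiB; apply: (raddfB (coeff x)).
  have [|c'0 c'D] := @zmod_morphismD _ _ c'.
    by move=> v w; rewrite /c' raddfB /= rmorphB.
  rewrite -/(c u) -/(c' u) -[u]freeg_sumE (big_morph c cD c0) (big_morph c' c'D c'0).
  apply: eq_bigr => z _; rewrite /c /c' /phi liftU.
  rewrite -[_ *: _]/((<< z >> : {freeg M / rat}) *~ _).
  rewrite freegU_mulz !coeffU rmorphM /=. by rewrite rmorph_nat.
exists D, (fun m => p << m >>); split.
- move=> d n n0; have [v <-] := pS d.
  exists (p (n%:R^-1 *: v)).
  have pMn w k : p (w *+ k) = p w *+ k.
    by elim: k => [|k IHk]; rewrite ?p0 // !mulrS pD IHk.
  rewrite -pMn -scaler_nat scalerA mulfV ?scale1r //.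
  by rewrite Num.Theory.pnatr_eq0 -lt0n.
- move=> x y; apply/eqP; rewrite -subr_eq0 -!pB; apply/eqP/pE/asboolP.
  exists (<< x - y >> - (<< x >> - << y >>)).
  by rewrite !phiB !evB !phiU !evU subrr.
- move=> x y /eqP; rewrite -subr_eq0 -pB => /eqP/pE/asboolP[u [uE u0]].
  have uE' : u = << x >> - << y >>.
    apply/eqP/freeg_eqP => z; apply: (@intr_inj rat).
    by rewrite -!coeff_phi uE phiB !phiU.
  by move: u0; rewrite uE' evB !evU => /eqP; rewrite subr_eq0 => /eqP.
Qed.

Lemma ex_injective_embedding (R : pzRingType) (M : lmodType R) :
  exists (E : lmodType R) (e : {linear M -> E}), injective_module E /\ injective e.
Proof.
have [D [j [D_div jB jI]]] := ex_divisible_embedding M.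
have [h hE] := ex_coind_map jB.
exists (coind R D), h; split; first exact: coind_injective.
by move=> x y hxy; apply: jI; rewrite -[x]scale1r -[y]scale1r -!hE hxy.
Qed.

(** * Existence of injective envelopes *)

Section Envelope.
Import classical_sets functions.
Local Open Scope classical_set_scope.

Lemma injective_retract (R : pzRingType) (E I : lmodType R)
    (k : {linear E -> I}) (r : {linear I -> E}) :
  (forall x, r (k x) = x) -> injective_module I -> injective_module E.
Proof.
move=> rk II M N i f iI; have [h hE] := II _ _ i (k \o f) iI.
by exists (r \o h) => x; rewrite /= hE /= rk.
Qed.

Section InjectiveEnvelope.
Variable R : pzRingType.
Implicit Types M E I : lmodType R.

Definition set_submod I (S : set I) :=
  S 0 /\ forall a u v, S u -> S v -> S (a *: u + v).

Lemma bigcup_submod I (F : set (set I)) :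
  F !=set0 -> F `<=` @set_submod I -> total_on F subset ->
  set_submod (\bigcup_(X in F) X).
Proof.
move=> [X FX] FP Ftot; split=> [|a u v [Y FY Yu] [Z FZ Zv]].
  by exists X => //; case: (FP _ FX).
have [YZ|ZY] := Ftot _ _ FY FZ.
  by exists Z => //; case: (FP _ FZ) => _; apply=> //; apply: YZ.
by exists Y => //; case: (FP _ FY) => _; apply=> //; apply: ZY.
Qed.

Lemma image_set_submod M I (e : {linear M -> I}) : set_submod (range e).
Proof.
split=> [|a u v [x _ <-] [y _ <-]]; first by exists 0; rewrite ?linear0.
by exists (a *: x + y); rewrite ?linearP.
Qed.

Definition set_essential I (S T : set I) :=
  forall y, T y -> y <> 0 -> exists r, S (r *: y) /\ r *: y <> 0.

(** Inside an injective I containing M, take a maximal essential extension N of M, then C maximal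
    among submodules meeting N trivially. Then N is essential in I / C, so an extension of N -> I to
    I / C has image essential over M. By maximality that image lies in N, and N is a direct summand
    of I. *)
Lemma ex_injective_envelope M : exists (E : lmodType R) (e : {linear M -> E}),
  [/\ injective_module E, injective e & essential_image e].
Proof.
have [I [e0 [II e0I]]] := ex_injective_embedding M.
pose P (S : set I) := set_submod S /\ set_essential (range e0) S.
have P0 : P (range e0).
  split; first exact: image_set_submod.
  by move=> y ey y0; exists 1; rewrite scale1r.
have [F F0 FP Ftot|N [e0N [Nsub Ness] Nmax]] := Zorn_above P0.
  split; first by apply: bigcup_submod => // X /FP[].
  by move=> y [Y /FP[_ Yess] Yy]; apply: Yess.
pose PC (S : set I) := set_submod S /\ forall y, S y -> N y -> y = 0.
have PC0 : PC [set 0].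
  by split=> [|y ->//]; split=> // a u v -> ->; rewrite scaler0 addr0.
have [F F0 FP Ftot|C [_ [Csub CN] Cmax]] := Zorn_above PC0.
  split; first by apply: bigcup_submod => // X /FP[].
  by move=> y [Y /FP[_ Y0] Yy]; apply: Y0.
have subP (S : set I) : set_submod S -> submod_closed [pred y | `[< S y >]].
  move=> [S0 SD]; split=> [|a u v]; first exact/asboolP.
  by move=> /asboolP Su /asboolP Sv; apply/asboolP/SD.
have [Q [p [pS pE']]] := ex_quotient (subP _ Csub).
have pE y : p y = 0 <-> C y.
  by rewrite pE'; split=> [/asboolP|?]; last exact/asboolP.
have [E [k [kI kE']]] := ex_submodule (subP _ Nsub).
have kE y : N y <-> exists x, k x = y.
  by rewrite -kE'; split=> [?|/asboolP//]; exact/asboolP.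
have Nk x : N (k x) by apply/kE; exists x.
have pkI : injective (p \o k).
  by apply/linear_injP => x /pE Ckx; apply: kI; rewrite linear0 (CN _ Ckx).
have [phi phiE] := II _ _ (p \o k) k pkI.
have Qess q : q <> 0 -> exists r x, r *: q = p (k x) /\ k x <> 0.
  have [y <-] := pS q => q0; apply: contrapT => nex.
  have CD c d : C c -> C d -> C (c + d).
    by move=> Cc Cd; rewrite -[c]scale1r; apply: Csub.2.
  pose C1 : set I := [set z | exists c r, C c /\ z = c + r *: y].
  (* If no multiple of [q] were a nonzero element of N, the larger submodule C + R y would still
     meet N trivially. *)
  have C1P : PC C1.
    split; first split.
    - by exists 0, 0; rewrite scale0r addr0; split=> //; apply: Csub.1.
    - move=> a u v [c [r [Cc ->]]] [d [s [Cd ->]]].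
      exists (a *: c + d), (a * r + s); split; first exact: Csub.2.
      by rewrite scalerDl scalerDr scalerA addrACA.
    - move=> z [c [r [Cc zE]]] /kE[x xE]; apply: contrapT => z0; apply: nex.
      exists r, x; rewrite xE zE linearD linearZ /= (iffRL (pE c) Cc) add0r.
      by split=> //; rewrite -zE.
  apply: q0; apply/pE; apply: (Cmax C1) => // [z Cz|].
    by exists z, 0; rewrite scale0r addr0.
  by exists 0, 1; rewrite scale1r add0r; split=> //; apply: Csub.1.
have phik x : phi (p (k x)) = k x by apply: phiE.
have phiN q : N (phi q).
  suff: P (range phi).
    move=> phiP; apply: (Nmax (range phi)) => //.
    by move=> y /kE[x <-]; exists (p (k x)); rewrite ?phik.
  split; first exact: image_set_submod.
  move=> y [{}q _ <-] y0.
  have [|r [x [rq kx0]]] := Qess q; first by move=> q0; apply: y0; rewrite q0 linear0.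
  have rE : r *: phi q = k x by rewrite -linearZ rq phik.
  have [s []] := Ness _ (Nk x) kx0; rewrite -rE scalerA.
  by exists (s * r).
have [|rho rhoE] := factor_inj (f := phi \o p) kI.
  by move=> y; apply/kE/phiN.
have rhok x : rho (k x) = x by apply: kI; rewrite rhoE /= phik.
have [|e eE] := factor_inj (f := e0) kI.
  by move=> y; apply/kE/e0N; exists y.
exists E, e; split.
- exact: injective_retract rhok II.
- by move=> x y exy; apply: e0I; rewrite -!eE exy.
move=> S [S0 SD] eS y Sy; apply: contrapT => y0.
have ky0 : k y <> 0 by move=> ky; apply: y0; apply: kI; rewrite ky linear0.
have [r [[m _ mE] ry0]] := Ness _ (Nk y) ky0; apply: ry0.
have ery : e m = r *: y by apply: kI; rewrite eE mE linearZ.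
rewrite -mE -eE eS ?linear0 // ery -[_ *: _]addr0.
exact: SD.
Qed.

End InjectiveEnvelope.

End Envelope.

(** * Noetherian rings and flat modules *)

Section FreeRow.
Variable R : pzRingType.
Implicit Types A B C F M N K : lmodType R.

Lemma ex_row_map n M (v : 'I_n -> M) :
  exists h : {linear 'rV[R]_n -> M}, forall x, h x = \sum_j x 0 j *: v j.
Proof.
apply: ex_linear => a x y; rewrite scaler_sumr -big_split.
by apply: eq_bigr => j _; rewrite !mxE scalerDl scalerA.
Qed.

Lemma linear_row n M (h : {linear 'rV[R]_n -> M}) x :
  h x = \sum_j x 0 j *: h (delta_mx 0 j).
Proof.
by rewrite {1}[x]row_sum_delta linear_sum; apply: eq_bigr => j _; rewrite linearZ.
Qed.

Lemma row_projective n : projective_module 'rV[R]_n.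
Proof.
move=> M N p f pS; have [s sE] := choice pS.
have [h hE] := ex_row_map (fun j => s (f (delta_mx 0 j))); exists h => x.
rewrite hE linear_sum [RHS]linear_row; apply: eq_bigr => j _.
by rewrite linearZ /= sE.
Qed.

Definition fin_gen M := exists n (p : {linear 'rV[R]_n -> M}), surjective p.

Fixpoint spans M (s : seq M) (x : M) : Prop :=
  if s is v :: s' then exists r, spans s' (x - r *: v) else x = 0.

Definition prop_submod M (S : M -> Prop) :=
  S 0 /\ forall a u v, S u -> S v -> S (a *: u + v).

Lemma spans_submod M (s : seq M) : prop_submod (spans s).
Proof.
split; first by elim: s => //= v s IHs; exists 0; rewrite scale0r subr0.
move=> a; elim: s => [|w s IHs] x y /=; first by move=> -> ->; rewrite scaler0 addr0.
move=> [r xr] [t yt]; exists (a * r + t).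
by rewrite scalerDl opprD addrACA -scalerA -scalerBr; apply: IHs.
Qed.

Lemma spans_cat M (s t : seq M) x y : spans s x -> spans t y -> spans (s ++ t) (x + y).
Proof.
elim: s x => [|v s IHs] x /=; first by move=> ->; rewrite add0r.
by move=> [r xr] ty; exists r; rewrite addrAC; apply: IHs.
Qed.

Lemma spans_sub M (s : seq M) (S : M -> Prop) x : prop_submod S ->
  (forall v, v \in s -> S v) -> spans s x -> S x.
Proof.
move=> [S0 SD]; elim: s x => [|v s IHs] x sS /=; first by move=> ->.
move=> [r xr]; rewrite -[x](subrK (r *: v)) addrC; apply: SD.
  by apply: sS; rewrite inE eqxx.
by apply: IHs xr => w ws; apply: sS; rewrite inE ws orbT.
Qed.

Lemma spans_map M N (f : {linear M -> N}) (s : seq M) y :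
  spans (map f s) y -> exists x, spans s x /\ f x = y.
Proof.
elim: s y => [|v s IHs] y /=; first by move=> ->; exists 0; rewrite linear0.
move=> [r /IHs[x [xs xE]]]; exists (x + r *: v); split; first by exists r; rewrite addrK.
by rewrite linearD linearZ /= xE subrK.
Qed.

Lemma lift_seq M N (f : M -> N) (S : M -> Prop) (s : seq N) :
    (forall y, y \in s -> exists x, S x /\ f x = y) ->
  exists t : seq M, (forall x, x \in t -> S x) /\ map f t = s.
Proof.
elim: s => [|y s IHs] sE; first by exists [::].
have [|t [tS tE]] := IHs; first by move=> z zs; apply: sE; rewrite inE zs orbT.
have [|x [Sx xE]] := sE y; first by rewrite inE eqxx.
exists (x :: t); split=> [z|]; last by rewrite /= xE tE.
by rewrite inE => /orP[/eqP ->|/tS].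
Qed.

Definition noetherian M := forall S : M -> Prop, prop_submod S ->
  exists s : seq M, (forall x, x \in s -> S x) /\ forall x, S x -> spans s x.

(** [f] and [g] embed B in C × A. A submodule S is generated by lifts of generators of f(S) and of
    g(S ∩ ker f). *)
Lemma noetherian_jointly_inj A B C (f : {linear B -> C}) (g : {linear B -> A}) :
    (forall x, f x = 0 -> g x = 0 -> x = 0) ->
  noetherian A -> noetherian C -> noetherian B.
Proof.
move=> fg An Cn S [S0 SD].
have [|s [sS Ss]] := Cn (fun y => exists x, S x /\ f x = y).
  split=> [|a u v [x [Sx <-]] [y [Sy <-]]]; first by exists 0; rewrite linear0.
  by exists (a *: x + y); rewrite linearP; split=> //; apply: SD.
have [|t [tS St]] := An (fun y => exists x, (S x /\ f x = 0) /\ g x = y).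
  split=> [|a u v [x [[Sx fx] <-]] [y [[Sy fy] <-]]].
    by exists 0; rewrite !linear0.
  exists (a *: x + y); rewrite !linearP fx fy /= scaler0 addr0; split=> //; split=> //.
  exact: SD.
have [s' [s'S s'E]] := lift_seq sS; have [t' [t'S t'E]] := lift_seq tS.
exists (s' ++ t'); split=> [x|x Sx].
  by rewrite mem_cat => /orP[/s'S|/t'S[]].
have := Ss (f x); rewrite -s'E => /(_ (ex_intro _ x (conj Sx erefl))).
move=> /spans_map[y [ys fy]].
have Sy : S y by apply: spans_sub ys.
have SB u v : S u -> S v -> S (u - v).
  by move=> Su Sv; rewrite addrC -scaleN1r; apply: SD.
have fxy : f (x - y) = 0 by rewrite linearB /= fy subrr.
have := St (g (x - y)); rewrite -t'E => /(_ (ex_intro _ _ (conj (conj (SB _ _ Sx Sy) fxy) erefl))).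
move=> /spans_map[z [zt gz]].
have [Sz fz] : S z /\ f z = 0.
  apply: (spans_sub (S := fun z => S z /\ f z = 0)) zt => //.
  split=> [|a u v [Su fu] [Sv fv]]; first by rewrite linear0.
  by rewrite linearP fu fv scaler0 addr0; split=> //; apply: SD.
have -> : x = y + z.
  apply/eqP; rewrite -subr_eq0 opprD addrA; apply/eqP/fg.
    by rewrite linearB /= fxy fz subrr.
  by rewrite linearB /= gz subrr.
exact: spans_cat.
Qed.

Lemma noetherian_inj A B (f : {linear A -> B}) :
  injective f -> noetherian B -> noetherian A.
Proof.
move=> /linear_injP fI Bn.
by apply: (noetherian_jointly_inj (f := f) (g := f)) => // x /fI.
Qed.

Lemma noetherian_surj A B (f : {linear A -> B}) :
  surjective f -> noetherian A -> noetherian B.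
Proof.
move=> fS An S [S0 SD]; have [|s [sS Ss]] := An (fun x => S (f x)).
  by split=> [|a u v Su Sv]; [rewrite linear0|rewrite linearP; apply: SD].
exists (map f s); split=> [_ /mapP[x xs ->]|y]; first exact: sS.
have [x <-] := fS y => /Ss; elim: (s) x => [|v s' IHs] x /=.
  by move=> ->; rewrite linear0.
by move=> [r /IHs]; rewrite linearB linearZ; exists r.
Qed.

Lemma left_noetherian_regular : left_noetherian R -> noetherian (R^o : lmodType R).
Proof.
move=> Rn I [I0 ID]; apply: contrapT => nfg.
have H (t : seq R^o) : exists x, (forall v, v \in t -> I v) -> I x /\ ~ spans t x.
  have [tI|] := pselect (forall v, v \in t -> I v); last by exists 0.
  apply: contrapT => nex; apply: nfg; exists t; split=> // x Ix.
  by apply: contrapT => ntx; apply: nex; exists x.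
have [F FE] := choice H.
(* If [I] is not finitely generated, each step adds an element of [I] outside the span so far; the
   spans never stabilise. *)
pose t n := iter n (fun t => F t :: t) [::].
have tI n v : v \in t n -> I v.
  elim: n v => [//|n IHn] v; rewrite /= inE => /orP[/eqP ->|/IHn//].
  by have [] := FE _ IHn.
pose J n : {pred R^o} := fun x => `[< spans (t n) x >].
have [|n x|N NE] := Rn J.
- move=> n; have [s0 sD] := spans_submod (t n); split=> [|a u v]; first exact/asboolP.
  by move=> /asboolP Ju /asboolP Jv; apply/asboolP/sD.
- move=> /asboolP xt; apply/asboolP; exists 0; by rewrite scale0r subr0.
have [_] := FE _ (tI N); apply; apply/asboolP.
rewrite -[asbool _]/(F (t N) \in J N) -(NE N.+1) //; apply/asboolP.
by exists 1; rewrite scale1r subrr; case: (spans_submod (t N)).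
Qed.

Lemma row_noetherian n : left_noetherian R -> noetherian 'rV[R]_n.
Proof.
move=> /left_noetherian_regular Rn; elim: n => [|n IHn].
  by move=> S _; exists [::]; split=> // x _ /=; apply/rowP; case.
have fl : linear (fun x : 'rV[R]_n.+1 => x 0 ord0 : R^o) by move=> a x y; rewrite !mxE.
have gl : linear (fun x : 'rV[R]_n.+1 => \row_j x 0 (fintype.lift ord0 j)).
  by move=> a x y; apply/rowP => j; rewrite !mxE.
have [[f fE] [g gE]] := (ex_linear fl, ex_linear gl).
apply: (noetherian_jointly_inj (f := f) (g := g)) => // x.
rewrite fE gE => x0 /rowP x1; apply/rowP => i; rewrite [RHS]mxE.
have [j ->|->] := unliftP ord0 i; last exact: x0.
by have := x1 j; rewrite !mxE.
Qed.

Lemma fin_gen_noetherian M : left_noetherian R -> fin_gen M -> noetherian M.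
Proof.
by move=> Rn [n [p pS]]; apply: (noetherian_surj pS); apply: row_noetherian.
Qed.

Lemma noetherian_fin_gen M : noetherian M -> fin_gen M.
Proof.
move=> /(_ (fun=> True))[//|s [_ sE]].
have [p pE] := ex_row_map (fun j : 'I_(size s) => s`_j).
exists (size s), p => x; move: (sE x I); clear sE.
suff claim : spans s x -> exists y : 'rV_(size s), \sum_j y 0 j *: s`_j = x.
  by move=> /claim[y yE]; exists y; rewrite pE.
elim: s {p pE} x => [|v s IHs] x /=; first by move=> ->; exists 0; rewrite big_ord0.
move=> [r /IHs[y yE]]; exists (row_mx (r%:M : 'rV_1) y : 'rV_(1 + size s)).
rewrite big_ord_recl /= -[X in _ = X](subrK (r *: v)) -yE addrC; congr (_ + _).
  apply: eq_bigr => j _; congr (_ *: _).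
  have -> : fintype.lift ord0 j = rshift 1 j :> 'I_(1 + size s) by apply/ord_inj.
  exact: (row_mxEr (r%:M : 'M_1) y 0 j).
have -> : ord0 = lshift (size s) ord0 :> 'I_(1 + size s) by apply/ord_inj.
rewrite [X in X *: _](row_mxEl (r%:M : 'M_1) y 0 ord0).
by rewrite mxE mulr1n.
Qed.

Lemma fin_gen_sub M N (i : {linear N -> M}) :
  left_noetherian R -> injective i -> fin_gen M -> fin_gen N.
Proof.
move=> Rn iI /(fin_gen_noetherian Rn)/(noetherian_inj iI).
exact: noetherian_fin_gen.
Qed.

Lemma row_fin_gen n : fin_gen 'rV[R]_n.
Proof. by exists n, idfun => x; exists x. Qed.

End FreeRow.

(** * Maps from finitely generated modules to flat modules *)

Section FlatFactor.
Variable R : pzRingType.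
Implicit Types F M N K : lmodType R.

(** The j-th component of the identification of R^n ⊗ F with F^n; it reads [y j] off [w]. *)
Lemma tens_row_eq0 n F (y : 'I_n -> F) (w : tensor ('rV[R^c]_n) F) :
  w = \sum_j tens (delta_mx 0 j) (y j) -> forall j, exists c : tensor ('rV[R^c]_n) F -> F,
  [/\ zmod_morphism c, forall u z, c (tens u z) = (u 0 j : R) *: z & c w = y j].
Proof.
move=> wE j; pose c (u : 'rV[R^c]_n) (z : F) := (u 0 j : R) *: z.
have cDl u u' z : c (u + u') z = c u z + c u' z by rewrite /c mxE scalerDl.
have cDr u z z' : c u (z + z') = c u z + c u z' by rewrite /c scalerDr.
have cZ (r : R) u z : c ((r : R^c) *: u) z = c u (r *: z).
  by rewrite /c mxE scalerA.
have cB := tensor_liftB cDl cDr cZ; have [c0 cD] := zmod_morphismD cB.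
exists (tensor_lift c); split=> // [u z|]; first by rewrite tensor_liftE.
rewrite wE (big_morph _ cD c0) (bigD1 j) //= big1 ?addr0 => [|i /negPf ij].
  by rewrite tensor_liftE // /c mxE !eqxx scale1r.
by rewrite tensor_liftE // /c mxE eqxx eq_sym ij scale0r.
Qed.

(* The relations between the images of the generators of [N] in [F] form a    *)
(* matrix, whose right kernel computes, by flatness, how the images of the    *)
(* generators arise from elements of [F].                                     *)
Lemma flat_factor_row F N (f : {linear N -> F}) :
    left_noetherian R -> flat_module F -> fin_gen N ->
  exists m (g : {linear N -> 'rV[R]_m}) (h : {linear 'rV[R]_m -> F}),
    forall x, h (g x) = f x.
Proof.
move=> Rn Ff [n [p pS]].
have [K [k [kI kE]]] := ex_kernel p.
have [l [q qS]] := fin_gen_sub Rn kI (row_fin_gen R n).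
pose v i : 'rV[R]_n := k (q (delta_mx 0 i)).
pose y j := f (p (delta_mx 0 j)).
have vy i : \sum_j v i 0 j *: y j = 0.
  rewrite -[LHS](linear_row (f \o p)) /= [X in f X](_ : _ = 0) ?linear0 //.
  by apply/kE; exists (q (delta_mx 0 i)).
have phil : linear (fun u : 'rV[R^c]_n => \row_i \sum_j u 0 j * (v i 0 j : R^c)).
  move=> a u w; apply/rowP => i; rewrite !mxE mulr_sumr -big_split.
  by apply: eq_bigr => j _; rewrite !mxE /= mulrDl mulrA.
have [phi phiE] := ex_linear phil.
have [L [lam [lamI lamE]]] := ex_kernel phi.
pose t : tensor ('rV[R^c]_n) F := \sum_j tens (delta_mx 0 j) (y j).
have phit : tensor_map phi (@idfun F) t = 0.
  rewrite raddf_sum /=.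
  transitivity (\sum_j \sum_i tens (delta_mx 0 i : 'rV[R^c]_l) (v i 0 j *: y j)).
    apply: eq_bigr => j _; rewrite tensor_mapE [phi _]row_sum_delta tens_suml.
    apply: eq_bigr => i _; rewrite tensZ; congr (tens _ (_ *: _)).
    rewrite phiE mxE (bigD1 j) //= big1 ?addr0 => [|j' /negPf jj'].
      by rewrite mxE !eqxx mul1r.
    by rewrite mxE eqxx jj' mul0r.
  rewrite exchange_big big1 // => i _.
  by rewrite -tens_sumr vy tens0r.
have /(Ff _ _ _ _ _ lamE)[w wE] := phit.
have [s sE] := tensor_sum w.
have yE j : y j = \sum_(a <- s) (lam a.1 0 j : R) *: a.2.
  have [c [cB cE cy]] := tens_row_eq0 (erefl t) j; have [c0 cD] := zmod_morphismD cB.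
  rewrite -cy -wE sE raddf_sum (big_morph _ cD c0); apply: eq_bigr => a _.
  by rewrite /= tensor_mapE cE.
pose m := size s; pose a0 : L * F := (0, 0).
have gl : linear (fun x : 'rV[R]_n =>
    \row_(i < m) \sum_j x 0 j * (lam (nth a0 s i).1 0 j : R)).
  move=> r u u'; apply/rowP => i; rewrite !mxE mulr_sumr -big_split.
  by apply: eq_bigr => j _; rewrite !mxE /= mulrDl mulrA.
have [g gE] := ex_linear gl.
have [h hE] := ex_row_map (fun i : 'I_m => (nth a0 s i).2).
have hg x : h (g x) = f (p x).
  rewrite hE [RHS](linear_row (f \o p)) /=.
  under eq_bigr do rewrite gE mxE scaler_suml.
  rewrite exchange_big; apply: eq_bigr => j _.
  rewrite -/(y j) yE (big_nth a0) big_mkord scaler_sumr.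
  by apply: eq_bigr => i _; rewrite scalerA.
have gv i : g (v i) = 0.
  apply/rowP => b; rewrite gE !mxE.
  have /lamE/rowP/(_ i) : exists x, lam x = lam (nth a0 s b).1 by exists (nth a0 s b).1.
  by rewrite phiE !mxE.
have [|g' g'E] := factor_surj (f := g) pS.
  move=> x /kE[z <-]; have [c <-] := qS z.
  rewrite -[g _]/((g \o k \o q) c) linear_row big1 // => i _.
  by rewrite [X in _ *: X]gv scaler0.
exists m, g', h => x; have [z <-] := pS x; by rewrite g'E hg.
Qed.

End FlatFactor.

(** * Injective coresolutions *)

Section Coresolutions.
Variable R : pzRingType.
Implicit Types A B C E I M N P Q W Y Z : lmodType R.

Lemma injective_prod A B :
  injective_module A -> injective_module B -> injective_module (A * B)%type.
Proof.
move=> AI BI M N i f iI.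
have [h hE] := AI _ _ i (fst \o f) iI; have [g gE] := BI _ _ i (snd \o f) iI.
have [k kE] := ex_pairing h g; exists k => x.
by rewrite kE hE gE /= -surjective_pairing.
Qed.

Lemma flat_dim_le_retract M N n (s : {linear N -> M}) (r : {linear M -> N}) :
  (forall x, r (s x) = x) -> flat_dim_le M n -> flat_dim_le N n.
Proof.
move=> rs Mn; apply: flat_dim_le_local => l.
by exists N, M, idfun, s, r; split=> // x _; exists x.
Qed.

(* The coresolution need not be minimal. *)
Fixpoint cores k n M : Prop :=
  if n is n'.+1 then
    exists (E C : lmodType R) (e : {linear M -> E}) (p : {linear E -> C}),
    [/\ injective_module E, short_exact e p, flat_dim_le E k & cores k.+1 n' C]
  else True.

Lemma cores_mono k k' n M : (k <= k')%N -> cores k n M -> cores k' n M.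
Proof.
elim: n k k' M => [//|n IHn] k k' M kk' [E [C [e [p [EI ep Ek Cn]]]]].
exists E, C, e, p; split=> //; first exact: flat_dim_le_mono Ek.
exact: IHn Cn.
Qed.

(** B embeds in EA × EC by an extension of A -> EA together with C -> EC. The cokernels again form a
    short exact sequence, to which the induction applies. *)
Lemma cores_horseshoe k n A B C (f : {linear A -> B}) (g : {linear B -> C}) :
  short_exact f g -> cores k n A -> cores k n C -> cores k n B.
Proof.
elim: n k A B C f g => [//|n IHn] k A B C f g [fI fgE gS].
move=> [EA [ZA [a [pA [EAI [aI apE pAS] EAk ZAn]]]]].
move=> [EC [ZC [c [pC [ECI [cI cpE pCS] ECk ZCn]]]]].
have gf x : g (f x) = 0 by apply/fgE; exists x.
have [a' a'E] := EAI _ _ f a fI.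
have [e eE] := ex_pairing a' (c \o g).
have eI : injective e.
  apply/linear_injP => b; rewrite eE => -[a'b /= cgb].
  have /fgE[x xE] : g b = 0 by apply: cI; rewrite linear0.
  by rewrite -xE (_ : x = 0) ?linear0 //; apply: aI; rewrite linear0 -a'E xE.
have [ZB [p ep]] := short_exact_coker eI; have [_ epE pS] := ep.
exists (EA * EC)%type, ZB, e, p; split=> //.
- exact: injective_prod.
- exact: flat_dim_le_prod.
have [inl inlE] := ex_inl EA EC.
have [|u uE] := factor_surj (f := p \o inl) pAS.
  move=> x /apE[y <-]; apply/epE; exists (f y).
  by rewrite eE /= inlE a'E gf linear0.
have [|w wE] := factor_surj (f := pC \o snd) pS.
  by move=> x /epE[b <-]; rewrite /= eE; apply/cpE; exists (g b).
apply: (IHn _ _ _ _ u w) => //; split.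
- apply/linear_injP => z; have [x <-] := pAS z; rewrite uE /= inlE.
  move=> /epE[b]; rewrite eE => -[bx /= cgb].
  have /fgE[y yE] : g b = 0 by apply: cI; rewrite linear0.
  by apply/apE; exists y; rewrite -bx -yE a'E.
- move=> z; split=> [|[t <-]]; last first.
    by have [x <-] := pAS t; rewrite uE /= wE /= inlE linear0.
  have [[x y] <-] := pS z; rewrite wE /= => /cpE[t].
  have [b <-] := gS t => yE.
  exists (pA (x - a' b)); rewrite uE /= inlE.
  have -> : (x - a' b, 0) = (x, y) - e b.
    by rewrite eE -yE -[RHS]/(x - a' b, c (g b) - c (g b)) subrr.
  by rewrite linearB /= [p (e b)](_ : _ = 0) ?subr0 //; apply/epE; exists b.
- move=> z; have [y <-] := pCS z; exists (p (0, y)); by rewrite wE.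
Qed.

(** The first injective E of B also serves A. Its cokernel E / A sits in 0 -> C -> E / A -> E / B ->
    0, with both ends at level k + 1, so the horseshoe applies. *)
Lemma cores_kernel k n A B C (f : {linear A -> B}) (g : {linear B -> C}) :
  short_exact f g -> cores k n.+1 B -> cores k.+1 n C -> cores k n.+1 A.
Proof.
move=> [fI fgE gS] [E [ZB [e [p [EI [eI epE pS] Ek ZBn]]]]] Cn.
have efI : injective (e \o f) by move=> x y /eI/fI.
have [W [q efq]] := short_exact_coker efI; have [_ qE qS] := efq.
exists E, W, (e \o f), q; split=> //.
have [|u uE] := factor_surj (f := q \o e) gS.
  by move=> b /fgE[a <-]; apply/qE; exists a.
have [|w wE] := factor_surj (f := p) qS.
  by move=> x /qE[a <-]; apply/epE; exists (f a).
apply: (cores_horseshoe (f := u) (g := w)) => //; split.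
- apply/linear_injP => c; have [b <-] := gS c; rewrite uE => /qE[a /= /eI <-].
  by apply/fgE; exists a.
- move=> y; split=> [|[c <-]].
    have [x <-] := qS y; rewrite wE => /epE[b <-].
    by exists (g b); rewrite uE.
  by have [b <-] := gS c; rewrite uE /= wE; apply/epE; exists b.
- by move=> z; have [x <-] := pS z; exists (q x).
Qed.

Lemma cores_zero n : (forall m, cores 0 m (R^o : lmodType R)) ->
  cores 0 n 'rV[R]_0.
Proof.
move=> Rn; case: n => [//|n].
(* The zero module is the kernel of the identity of R. *)
apply: (cores_kernel (B := R^o) (C := R^o) (f := \0) (g := idfun)) => //.
  split; first by move=> x y _; apply/rowP; case.
    by move=> y; split=> [y0|[x <-//]]; exists 0; apply: esym y0.
  by move=> x; exists x.
exact: (cores_mono (k := 0)).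
Qed.

Lemma cores_row n m : (forall m, cores 0 m (R^o : lmodType R)) ->
  cores 0 n 'rV[R]_m.
Proof.
move=> Rn; elim: m => [|m IHm]; first exact: cores_zero.
have fl : linear (fun x : 'rV[R]_m =>
    \row_(i < m.+1) if unlift ord0 i is Some j then x 0 j else 0).
  move=> a x y; apply/rowP => i; rewrite !mxE.
  by case: unliftP => [j|] _; rewrite ?mxE ?mulr0 ?addr0.
have gl : linear (fun x : 'rV[R]_m.+1 => x 0 ord0 : R^o).
  by move=> a x y; rewrite !mxE.
have [[f fE] [g gE]] := (ex_linear fl, ex_linear gl).
apply: (cores_horseshoe (f := f) (g := g)) => //; split.
- apply/linear_injP => x; rewrite fE => /rowP x0; apply/rowP => j.
  by have := x0 (fintype.lift ord0 j); rewrite !mxE liftK.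
- move=> y; rewrite gE; split=> [y0|[x <-]]; last by rewrite fE mxE unlift_none.
  exists (\row_j y 0 (fintype.lift ord0 j)); rewrite fE; apply/rowP => i.
  by rewrite !mxE; case: unliftP => [j ->|->]; rewrite ?mxE.
- by move=> r; exists (const_mx r); rewrite gE mxE.
Qed.

(** M is the kernel of X 0 -> C, and C is coresolved by the shifted sequence. To get n + 1 terms for
    M only n are needed for C, so the induction is on n. *)
Lemma cores_coresolution n M (X : nat -> lmodType R) (i : {linear M -> X 0})
    (d : forall j, {linear X j -> X j.+1}) :
    injective i -> exact_at i (d 0) -> (forall j, exact_at (d j) (d j.+1)) ->
  (forall j n, cores 0 n (X j)) -> cores 0 n M.
Proof.
elim: n M X i d => [//|n IHn] M X i d iI id0 dd Xn.
have [C [p ip]] := short_exact_coker iI; have [_ ipE pS] := ip.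
apply: (cores_kernel ip) => //; apply: (cores_mono (k := 0)) => //.
have [|e eE] := factor_surj (f := d 0) pS.
  by move=> x /ipE[m <-]; apply/id0; exists m.
apply: (IHn C (fun j => X j.+1) e (fun j => d j.+1)) => //.
  apply/linear_injP => c; have [x <-] := pS c; rewrite eE => /id0[m <-].
  by apply/ipE; exists m.
move=> y; rewrite (dd 0); split=> [[x <-]|[c <-]]; first by exists (p x).
by have [x <-] := pS c; exists x.
Qed.

Lemma cores_of_injective_coresolution k n M (E : nat -> lmodType R)
    (e : {linear M -> E 0}) (d : forall j, {linear E j -> E j.+1}) :
    injective e -> exact_at e (d 0) -> (forall j, exact_at (d j) (d j.+1)) ->
    (forall j, injective_module (E j)) -> (forall j, flat_dim_le (E j) (k + j)) ->
  cores k n M.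
Proof.
elim: n k M E e d => [//|n IHn] k M E e d eI ed dd EI Ek.
have [C [p ep]] := short_exact_coker eI; have [_ epE pS] := ep.
exists (E 0), C, e, p; split=> //; first by have := Ek 0; rewrite addn0.
have [|e' e'E] := factor_surj (f := d 0) pS.
  by move=> x /epE[m <-]; apply/ed; exists m.
apply: (IHn _ C (fun j => E j.+1) e' (fun j => d j.+1)) => //.
- apply/linear_injP => c; have [x <-] := pS c; rewrite e'E => /ed[m <-].
  by apply/epE; exists m.
- move=> y; rewrite (dd 0); split=> [[x <-]|[c <-]]; first by exists (p x).
  by have [x <-] := pS c; exists x.
- by move=> j; have := Ek j.+1; rewrite addSnnS.
Qed.

Lemma auslander_cores M n : auslander_condition M -> cores 0 n M.
Proof.
move=> [E [e [d [[EI [eI ed dd] _ _] En]]]].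
exact: (cores_of_injective_coresolution n eI ed dd).
Qed.

(* The cosyzygies are Z 0, Z 1, ... *)
Definition minimal_coresolution (Z E : nat -> lmodType R)
    (e : forall i, {linear Z i -> E i}) (p : forall i, {linear E i -> Z i.+1}) :=
  [/\ forall i, injective_module (E i), forall i, short_exact (e i) (p i)
    & forall i, essential_image (e i)].

(** Envelopes of successive cokernels. The start [Z 0] is given up to an isomorphism with M, which
    avoids transport along an equality of modules. *)
Lemma ex_minimal_coresolution M : exists (Z E : nat -> lmodType R)
    (e : forall i, {linear Z i -> E i}) (p : forall i, {linear E i -> Z i.+1})
    (s : {linear M -> Z 0}) (r : {linear Z 0 -> M}),
  [/\ minimal_coresolution e p, cancel s r & cancel r s].
Proof.
pose T A := {E : lmodType R & {C : lmodType R & ({linear A -> E} * {linear E -> C})%type}}.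
have env A : {t : T A | let: existT _ (existT _ (e, p)) := t in
    [/\ injective_module (projT1 t), short_exact e p & essential_image e]}.
  apply: cid; have [E [e [EI eI ess]]] := ex_injective_envelope A.
  have [C [p ep]] := short_exact_coker eI.
  by exists (existT _ E (existT _ C (e, p))).
pose Z n := iter n (fun A => projT1 (projT2 (sval (env A)))) M.
pose E n := projT1 (sval (env (Z n))).
pose e n : {linear Z n -> E n} := (projT2 (projT2 (sval (env (Z n))))).1.
pose p n : {linear E n -> Z n.+1} := (projT2 (projT2 (sval (env (Z n))))).2.
exists Z, E, e, p, idfun, idfun; split=> //.
split=> n; rewrite /E /e /p /=.
- by case: (env (Z n)) => -[E' [C [e' p']]] [].
- by case: (env (Z n)) => -[E' [C [e' p']]] [].
- by case: (env (Z n)) => -[E' [C [e' p']]] [].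
Qed.

Lemma minimal_auslander M (Z E : nat -> lmodType R) (e : forall i, {linear Z i -> E i})
    (p : forall i, {linear E i -> Z i.+1}) (s : {linear M -> Z 0})
    (r : {linear Z 0 -> M}) :
    minimal_coresolution e p -> cancel s r -> cancel r s ->
  (forall i, flat_dim_le (E i) i) -> auslander_condition M.
Proof.
move=> [EI ep ess] sr rs En.
exists E, (e 0 \o s), (fun i => e i.+1 \o p i); split=> //; split=> //.
- split.
  + by have [eI _ _] := ep 0 => x y /eI/(can_inj sr).
  + move=> y; have [_ epE _] := ep 0; have [eI _ _] := ep 1.
    split=> [/=|[x <-]] /=.
      rewrite -[X in _ = X](linear0 (e 1)) => /eI/epE[z <-].
      by exists (r z); rewrite /= rs.
    by rewrite [p 0 _](_ : _ = 0) ?linear0 //; apply/epE; exists (s x).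
  + move=> i y; have [_ _ pS] := ep i; have [_ epE _] := ep i.+1.
    have [eI _ _] := ep i.+2; split=> [/=|[x <-]] /=.
      rewrite -[X in _ = X](linear0 (e i.+2)) => /eI/epE[z <-].
      by have [x <-] := pS z; exists x.
    by rewrite [p i.+1 _](_ : _ = 0) ?linear0 //; apply/epE; exists (p i x).
- move=> S SP Se y Sy; apply: (ess 0 S SP) Sy => z; rewrite -[z]rs.
  exact: Se.
- move=> i S SP Se y Sy; apply: (ess i.+1 S SP) Sy => z.
  have [_ _ pS] := ep i; have [x <-] := pS z; exact: Se.
Qed.

(* A map between injective coresolutions lifting a split monomorphism out of  *)
(* a minimal one is a split monomorphism.                                     *)
Lemma cores_minimal n k M (Z E : nat -> lmodType R) (e : forall i, {linear Z i -> E i})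
    (p : forall i, {linear E i -> Z i.+1}) (s : {linear Z 0 -> M})
    (r : {linear M -> Z 0}) :
    minimal_coresolution e p -> cancel s r -> cores k n M ->
  forall i, (i < n)%N -> flat_dim_le (E i) (k + i).
Proof.
elim: n k M Z E e p s r => [//|n IHn] k M Z E e p s r [EI ep ess] sr.
move=> [I [C [e' [p' [II [e'I e'p'E p'S] Ik Cn]]]]].
have [eI epE pS] := ep 0.
have [psi psiE] := II _ _ (e 0) (e' \o s) eI.
have [rho0 rho0E] := EI 0 _ _ e' (e 0 \o r) e'I.
have sig_e x : rho0 (psi (e 0 x)) = e 0 x by rewrite psiE /= rho0E /= sr.
(* The endomorphism fixes the image of [e 0], so its kernel meets an essential submodule
   trivially. *)
have sigI : injective (rho0 \o psi).
  apply/linear_injP => y y0.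
  apply: (ess 0 _ (kernel_submod (rho0 \o psi))); last by rewrite inE y0.
  by move=> x; rewrite inE /= sig_e => /eqP.
have [tau tauE] := EI 0 _ _ (rho0 \o psi) idfun sigI.
have tau_e x : tau (e 0 x) = e 0 x by rewrite -{1}sig_e tauE.
pose rho := tau \o rho0.
have rhopsi x : rho (psi x) = x by apply: tauE.
have rhoe x : rho (e' x) = e 0 (r x) by rewrite /rho /= rho0E /= tau_e.
case=> [_|i i_n].
  by rewrite addn0; apply: flat_dim_le_retract rhopsi Ik.
(* The splitting descends to the cokernels, one step further along both coresolutions. *)
have [|s1 s1E] := factor_surj (f := p' \o psi) pS.
  by move=> x /epE[m <-]; apply/e'p'E; exists (s m); rewrite psiE.
have [|r1 r1E] := factor_surj (f := p 0 \o rho) p'S.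
  by move=> x /e'p'E[m <-]; apply/epE; exists (r m); exact: (esym (rhoe m)).
rewrite addnS -addSn; apply: (IHn _ C (fun j => Z j.+1) (fun j => E j.+1)
  (fun j => e j.+1) (fun j => p j.+1) s1 r1) => //.
move=> z; have [x <-] := pS z; rewrite s1E.
exact: etrans (r1E (psi x)) (congr1 (p 0) (rhopsi x)).
Qed.

Lemma cores_auslander M : (forall n, cores 0 n M) -> auslander_condition M.
Proof.
move=> Mn; have [Z [E [e [p [s [r [ep sr rs]]]]]]] := ex_minimal_coresolution M.
apply: (minimal_auslander ep sr rs) => i.
exact: (cores_minimal ep rs (Mn i.+1)).
Qed.

End Coresolutions.

(** * The Auslander condition *)

Section FlatModules.
Variable R : pzRingType.
Hypothesis Rnoeth : left_noetherian R.
Implicit Types A B C E I K M N P Q W Y Z : lmodType R.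

(* For q : E^(i-1) -> Z^i, the maps N -> Z^i modulo those factoring through q *)
(* form Ext^i (N, M): every class comes from some Ext^i (N, M') where the     *)
(* i-th cosyzygy W of M' satisfies [cores k n].                               *)
Definition ext_approx k n Y Z (q : {linear Y -> Z}) :=
  forall N (f : {linear N -> Z}), fin_gen N ->
  exists W (g : {linear N -> W}) (h : {linear W -> Z}) (u : {linear N -> Y}),
    (forall x, f x = h (g x) + q (u x)) /\ cores k n W.

(** Dimension shifting: a class in Ext^(i+1) of N = R^a / K is a class in Ext^i of K, which is
    finitely generated because R is Noetherian. The approximation for K is extended to R^a by
    injectivity of Y, I and E, then passed to quotients. *)
Lemma ext_approx_shift k n Y Z E Z' (q : {linear Y -> Z})
    (e : {linear Z -> E}) (p : {linear E -> Z'}) :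
    injective_module Y -> injective_module E -> short_exact e p ->
  ext_approx k n.+1 q -> ext_approx k.+1 n p.
Proof.
move=> YI EI [eI epE pS] qapx N f [a [pi piS]].
have [K [kap [kapI kapE]]] := ex_kernel pi.
have Kfg : fin_gen K := fin_gen_sub Rnoeth kapI (row_fin_gen R a).
have [ft ftE] := row_projective (f \o pi) pS.
have [|f' f'E] := factor_inj (f := ft \o kap) eI.
  move=> x; apply/epE; rewrite /= ftE /= (_ : pi _ = 0) ?linear0 //.
  by apply/kapE; exists x.
have [W [g [h [u [f'g [I [W' [iota [w [II [iI iwE wS] _ W'n]]]]]]]]]] := qapx K f' Kfg.
have [ut utE] := YI _ _ kap u kapI.
have [gt gtE] := II _ _ kap (iota \o g) kapI.
have [hI hIE] := EI _ _ iota (e \o h) iI.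
(* What is left of the lift [ft] once the extended approximation is removed; it vanishes on K, so it
   descends to N. *)
pose D := (ft \- (e \o q \o ut)) \- (hI \o gt).
have [|v vE] := factor_surj (f := D) piS.
  move=> x /kapE[y <-]; rewrite /D /=.
  have := f'E y; rewrite /= => <-; rewrite utE gtE /= hIE f'g linearD.
  by rewrite addrK subrr.
have [|gb gbE] := factor_surj (f := w \o gt) piS.
  by move=> x /kapE[y <-]; rewrite /= gtE /=; apply/iwE; exists (g y).
have [|hb hbE] := factor_surj (f := p \o hI) wS.
  by move=> x /iwE[y <-]; rewrite /= hIE /=; apply/epE; exists (h y).
exists W', gb, hb, v; split=> // x; have [y <-] := piS x.
rewrite gbE vE /= hbE /= -linearD.
have -> : hI (gt y) + (ft y - e (q (ut y)) - hI (gt y)) = ft y - e (q (ut y)).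
  by rewrite addrC subrK.
rewrite linearB /= ftE /= (_ : p (e _) = 0) ?subr0 //.
by apply/epE; exists (q (ut y)).
Qed.

(** The kernel of [q] is an essential submodule of Y. *)
Definition essential_kernel Y Z (q : {linear Y -> Z}) : Prop :=
  forall S : {pred Y}, submod_closed S -> (forall y, y \in S -> q y = 0 -> y = 0) ->
  forall y, y \in S -> y = 0.

Lemma essential_kernelP Z E Z' (e : {linear Z -> E}) (p : {linear E -> Z'}) :
  exact_at e p -> essential_image e -> essential_kernel p.
Proof.
move=> epE ess S SP Sp; apply: ess => // x Sx.
by apply: Sp => //; apply/epE; exists x.
Qed.

Lemma prop_submod_closed M (S : M -> Prop) :
  prop_submod S -> submod_closed [pred x | `[< S x >]].
Proof.
move=> [S0 SD]; split=> [|a u v]; first exact/asboolP.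
by move=> /asboolP Su /asboolP Sv; apply/asboolP/SD.
Qed.

(** For N in E generated by finitely many elements, approximate the inclusion of N' = N ∩ Z in Z.
    Essentiality of ker q forces N' -> W to be injective; essentiality of Z in E then makes its
    extension N -> I injective, so the inclusion of N in E factors through I, of flat dimension at
    most k. *)
Lemma flat_dim_le_envelope k n Y Z E (q : {linear Y -> Z}) (e : {linear Z -> E}) :
    essential_kernel q -> ext_approx k n.+1 q ->
    injective e -> essential_image e -> injective_module E ->
  flat_dim_le E k.
Proof.
move=> qess qapx eI ess EI; apply: flat_dim_le_local => s.
have [b bE] := ex_row_map (fun j : 'I_(size s) => s`_j).
have [N [pN [j [pNS jI jE]]]] := ex_image b.
have [Z' [p ep]] := short_exact_coker eI; have [_ epE pS] := ep.
have [N' [kap [kapI kapE]]] := ex_kernel (p \o j).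
have N'fg : fin_gen N'.
  by apply: (fin_gen_sub Rnoeth kapI); exists (size s), pN.
have [|f fE] := factor_inj (f := j \o kap) eI.
  by move=> x; apply/epE/kapE; exists x.
have fI : injective f.
  by move=> x y fxy; apply/kapI/jI; have := fE x; rewrite fxy fE.
(* Only the first injective [I] of the coresolution of [W] is used. *)
have [W [g [h [u [fg [I [C [iota [w [II [iI iwE wS] Ik _]]]]]]]]]] := qapx N' f N'fg.
have gI : injective g.
  apply/linear_injP => x gx0.
  suff ux0 : u x = 0 by apply: fI; rewrite linear0 fg gx0 ux0 !linear0 addr0.
  (* On ker g the map f is q u, so q is injective on u(ker g), which must vanish. *)
  pose S y := exists x, g x = 0 /\ u x = y.
  apply: (qess [pred y | `[< S y >]]); last by apply/asboolP; exists x.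
    apply: prop_submod_closed; split; first by exists 0; rewrite !linear0.
    move=> a _ _ [x1 [gx1 <-]] [x2 [gx2 <-]]; exists (a *: x1 + x2).
    by rewrite !linearP gx1 gx2 scaler0 addr0.
  move=> _ /asboolP[y [gy <-]] quy.
  have -> : y = 0 by apply: fI; rewrite linear0 fg gy quy linear0 addr0.
  by rewrite linear0.
have [al alE] := II _ _ kap (iota \o g) kapI.
have alI : injective al.
  apply/linear_injP => x alx0; apply: jI; rewrite linear0.
  pose S y := exists x, al x = 0 /\ j x = y.
  apply: (ess [pred y | `[< S y >]]); last by apply/asboolP; exists x.
    apply: prop_submod_closed; split; first by exists 0; rewrite !linear0.
    move=> a _ _ [x1 [ax1 <-]] [x2 [ax2 <-]]; exists (a *: x1 + x2).
    by rewrite !linearP ax1 ax2 scaler0 addr0.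
  move=> z /asboolP[y [aly jy]]; rewrite -jy.
  have /kapE[y' y'E] : p (j y) = 0 by rewrite jy; apply/epE; exists z.
  have y'0 : y' = 0 by apply: gI; apply: iI; rewrite !linear0 -[LHS]alE y'E.
  by rewrite -y'E y'0 !linear0.
have [be beE] := EI _ _ al j alI.
exists N, I, j, al, be; split=> // x xs.
have xi : (index x s < size s)%N by rewrite index_mem.
exists (pN (delta_mx 0 (Ordinal xi))); rewrite jE bE (bigD1 (Ordinal xi)) //=.
rewrite mxE !eqxx scale1r nth_index // big1 ?addr0 // => i /negPf ii.
by rewrite mxE eqxx ii scale0r.
Qed.

Lemma flat_auslander M : auslander_condition (R^o : lmodType R) ->
  flat_module M -> auslander_condition M.
Proof.
move=> Ra Mf; have Rn n : cores 0 n (R^o : lmodType R) by apply: auslander_cores.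
have [Z [E [e [p [s [r [epmin sr rs]]]]]]] := ex_minimal_coresolution M.
apply: (minimal_auslander epmin sr rs) => i; have [EI ep ess] := epmin.
have [Y [q [YI qess qapx]]] : exists Y (q : {linear Y -> Z i}),
    [/\ injective_module Y, essential_kernel q & forall n, ext_approx i n q].
  elim: i => [|i [Y [q [YI qess qapx]]]]; last first.
    have [eI epE pS] := ep i; exists (E i), (p i); split=> //.
      exact: essential_kernelP epE (ess i).
    by move=> n; apply: (ext_approx_shift YI (EI i) (ep i)).
  (* In degree 0 no maps are factored out: q = 0, whose kernel is all of Y, with [E 0] as an
     injective at hand. *)
  exists (E 0), \0; split=> // [S _ Sq y Sy|n N f Nfg]; first exact: Sq.
  have [m [g [h hg]]] := flat_factor_row (r \o f) Rnoeth Mf Nfg.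
  exists 'rV[R]_m, g, (s \o h), \0; split; last exact: cores_row.
  by move=> x; rewrite /= hg /= rs addr0.
have [eI _ _] := ep i.
exact: (flat_dim_le_envelope qess (qapx 1) eI (ess i) (EI i)).
Qed.

(** The right half of the complex is a coresolution of G. *)
Lemma syzygy_auslander G (P : two_sided_seq R) :
    exact_seq P -> is_syzygy G P -> (forall n, auslander_condition (Pr P n)) ->
  auslander_condition G.
Proof.
move=> [_ _ _ Pn] [i [iI iE]] Pa; apply: cores_auslander => n.
by apply: (cores_coresolution n iI iE Pn) => j m; apply: auslander_cores.
Qed.

Lemma auslander_retract M N (s : {linear N -> M}) (r : {linear M -> N}) :
  cancel s r -> auslander_condition M -> auslander_condition N.
Proof.
move=> sr Ma; have [Z [E [e [p [s' [r' [epmin sr' rs']]]]]]] := ex_minimal_coresolution N.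
apply: (minimal_auslander epmin sr' rs') => i.
apply: (cores_minimal (k := 0) (s := s \o r') (r := s' \o r) epmin _
  (auslander_cores i.+1 Ma)) => // x.
by rewrite /= sr rs'.
Qed.

Lemma auslander_resolving :
  auslander_condition (R^o : lmodType R) -> resolving (@auslander_condition R).
Proof.
move=> Ra; split.
- by move=> P Pp; apply: flat_auslander (projective_flat Pp).
- move=> M N N' f [f' f'K fK] Ma.
  (* The inverse [f'] is a bare function; this provides it as a linear map [g]. *)
  have [g gE] := factor_inj (f := @idfun M) (can_inj f'K) (fun x => ex_intro _ _ (fK x)).
  have [inl inlE] := ex_inl N N'.
  apply: (auslander_retract (s := f \o inl) (r := fst \o g) _ Ma) => x.
  by rewrite /= (_ : g _ = inl x) ?inlE //; apply: (can_inj f'K); rewrite gE.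
- move=> A B D f g fg Aa Da; apply: cores_auslander => n.
  by apply: (cores_horseshoe fg); apply: auslander_cores.
- move=> A B D f g fg Ba Da; apply: cores_auslander => -[//|n].
  apply: (cores_kernel fg); first exact: auslander_cores.
  by apply: (cores_mono (k := 0)) => //; apply: auslander_cores.
Qed.

End FlatModules.

(** * The regular module as a syzygy *)

Section Regular.
Variable R : pzRingType.
Implicit Types M N P Q : lmodType R.

Lemma regular_projective : projective_module (R^o : lmodType R).
Proof.
move=> M N p f pS; have [m mE] := pS (f 1).
have hl : linear (fun r : R^o => (r : R) *: m).
  by move=> a u v; rewrite scalerDl scalerA.
have [h hE] := ex_linear hl; exists h => r.
by rewrite hE linearZ /= mE -linearZ; congr (f _); apply: mulr1.
Qed.

Lemma projective_prod P Q :
  projective_module P -> projective_module Q -> projective_module (P * Q)%type.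
Proof.
move=> Pp Qp M N p f pS.
have [inl inlE] := ex_inl P Q; have [inr inrE] := ex_inr P Q.
have [h hE] := Pp _ _ p (f \o inl) pS; have [k kE] := Qp _ _ p (f \o inr) pS.
have [c cE] := ex_copairing h k; exists c => x.
rewrite cE linearD /= hE kE /= -linearD inlE inrE; congr (f _).
by rewrite -[LHS]/(x.1 + 0, 0 + x.2) addr0 add0r -surjective_pairing.
Qed.

(* ... -> X -> X -> X -> ... with X = R + R and d (x, y) = (y, 0), contracted *)
(* by s (x, y) = (0, x).                                                      *)
Lemma ex_contractible_seq : exists (P : two_sided_seq R),
  [/\ all_terms (@projective_module R) P, exact_seq P,
      is_syzygy (R^o : lmodType R) P, forall Q, hom_exact_seq Q P
    & forall E, tensor_exact_seq E P].
Proof.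
pose X : lmodType R := (R^o * R^o)%type.
have dl : linear (fun x : X => (x.2, 0) : X).
  by move=> a u v; rewrite -[RHS]/((a *: u).2 + v.2, a *: 0 + 0) scaler0 addr0.
have sl : linear (fun x : X => (0, x.1) : X).
  by move=> a u v; rewrite -[RHS]/(a *: 0 + 0, (a *: u).1 + v.1) scaler0 addr0.
have [[d dE] [s sE]] := (ex_linear dl, ex_linear sl).
have dd x : d (d x) = 0 by rewrite !dE.
have ds x : x = d (s x) + s (d x).
  by rewrite !(dE, sE) /= -[RHS]/(x.1 + 0, 0 + x.2) addr0 add0r -surjective_pairing.
have Xp : projective_module X by apply: projective_prod; apply: regular_projective.
have dexact : exact_at d d.
  move=> y; split=> [dy|[x <-]]; last exact: dd.
  by exists (s y); rewrite [RHS]ds dy linear0 addr0.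
exists (@TwoSidedSeq R (fun=> X) (fun=> X) (fun=> d) d (fun=> d)); split=> //.
(* R, as the first factor, is the kernel of d. *)
- have [inl inlE] := ex_inl R^o R^o; exists inl; split=> /=.
    by move=> x y; rewrite !inlE => -[].
  move=> y; rewrite dE; split=> [[y2]|[x <-]]; last by rewrite inlE.
  by exists y.1; rewrite inlE [RHS]surjective_pairing y2.
- move=> Q; suff H : hom_exact_at Q d d by split.
  move=> h; split=> [hd|[k kE] x]; last by rewrite -kE dd linear0.
  exists (h \o s) => y; by rewrite /= [in RHS](ds y) linearD /= hd add0r.
- move=> E; suff H : exact_at (tensor_map (@idfun E) d) (tensor_map (@idfun E) d).
    by split.
  move=> t; split=> [dt|[u <-]]; last first.
    by rewrite (tensor_map_comp (f2 := idfun) (g2 := \0)) // tensor_map_0r.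
  exists (tensor_map idfun s t); rewrite -[RHS](tensor_map_id (f := idfun) (g := idfun)) //.
  rewrite [RHS](tensor_map_Dr _ (g1 := d \o s) (g2 := s \o d)) //.
  rewrite -[X in _ = _ + X](tensor_map_comp (f := idfun) (f' := idfun) (g := d) (g' := s)) //.
  by rewrite dt raddf0 addr0 (tensor_map_comp (f2 := idfun) (g2 := d \o s)).
Qed.

End Regular.

Theorem theorem1p1 (R : pzRingType) (noethR : left_noetherian R) :
  [<-> resolving (@auslander_condition R);
       auslander_condition (R^o : lmodType R);
       forall G : lmodType R, gorenstein_projective G -> auslander_condition G;
       forall G : lmodType R, ding_projective G -> auslander_condition G;
       forall G : lmodType R, gorenstein_flat G -> auslander_condition G].
Proof.
have [P [Pp Pe Ps Ph Pt]] := ex_contractible_seq R.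
have flatP M : projective_module M -> flat_module M by apply: projective_flat.
(* The common core of the implications from (2): projective terms are flat, so all three kinds of
   complexes are covered. *)
have fromR Q G : auslander_condition (R^o : lmodType R) ->
    all_terms (@flat_module R) Q -> exact_seq Q -> is_syzygy G Q ->
    auslander_condition G.
  move=> Ra [_ Qf] Qe GQ; apply: (syzygy_auslander Qe GQ) => n.
  exact: flat_auslander.
tfae.
- by move=> [proj _ _ _]; apply/proj/regular_projective.
- move=> Ra G [Q [[Ql Qr] Qe GQ _]]; apply: (fromR Q) => //.
  by split=> n; apply: flatP.
(* The implication returns to (2), as R is a syzygy of the contractible complex; the next two cases
   proceed alike. *)
- move=> GP; have Ra : auslander_condition (R^o : lmodType R).
    by apply: GP; exists P; split.
  move=> G [Q [[Ql Qr] Qe GQ _]]; apply: (fromR Q) => //.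
  by split=> n; apply: flatP.
- move=> DP; have Ra : auslander_condition (R^o : lmodType R).
    by apply: DP; exists P; split.
  by move=> G [Q [Qf Qe GQ _]]; apply: (fromR Q).
- move=> GF; apply: auslander_resolving => //; apply: GF.
  exists P; split=> //; case: Pp => Pl Pr.
  by split=> n; apply: flatP.
Qed.
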